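(* Let $n\ge3$ be an odd integer, let $N_{\min}(n)<N<n$, and let $k=1$ if $n\in\{5,9,13,\ldots\}$ and $k=2$ if $n\in\{3,7,11,\ldots\}$. Then the level curve $L_{n,N}^{(k)}$ loops in both the upper and the lower half-planes. In the upper half-plane the self-intersection point is $$\rho_{\rm upper}=f_{n,N}^{(k)}\left(-\tfrac{\pi}{2}-u_0(n,N)\right)=f_{n,N}^{(k)}\left(-\tfrac{\pi}{2}+u_0(n,N)\right),$$ and in the lower half-plane it is $$\rho_{\rm lower}=f_{n,N}^{(k)}\left(\tfrac{\pi}{2}-u_0(n,N)\right)=f_{n,N}^{(k)}\left(\tfrac{\pi}{2}+u_0(n,N)\right).$$ Both self-intersection points lie on the imaginary axis. Furthermore, in the limit $N\to n-0$, each loop shrinks to a single point, namely the corresponding cusp (in the upper, respectively lower, half-plane) of the borderline curve $B_n^{(k)}=L_{n,n}^{(k)}$ on the imaginary axis.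
   Context: $K_n(\rho)=[\rho^{|j-k|}]_{j,k=1}^n$, $\rho\in\mathbb{C}$. An eigenvalue of $K_n(\rho)$ is of type-1 (type-2) if it is associated with a nonzero skew-symmetric eigenvector, $x_{n+1-j}=-x_j$ (symmetric eigenvector, $x_{n+1-j}=x_j$). $U_{k}$ is the Chebyshev polynomial of the second kind of degree $k$, $U_k(\cos u)=\sin[(k+1)u]/\sin u$. $N_{\min}(n)=|U_{n-1}(x_0'(n))|$, where $x_0'(n)$ is the unique solution of $U_{n-1}'(x)=0$ with $\cos\frac{2\pi}{n}<x<\cos\frac{\pi}{n}$. For $N_{\min}(n)<N<n$, $u_0(n,N)=\arccos[x_0(n,N)]$, where $x_0(n,N)$ is the unique positive solution of $|U_{n-1}(x)|=N$ in $-1<x<1$; $u_0(n,n)=0$. For $N_{\min}(n)<N\le n$ let $R(n,N)=[-\pi+u_0(n,N),-u_0(n,N)]\cup[u_0(n,N),\pi-u_0(n,N)]$. For $u\in R(n,N)$, $v(n,N,u)$ is the unique root $v\in[0,\infty)$ of $\sinh^2(nv)-N^2\sinh^2v=N^2\sin^2u-\sin^2(nu)$, $\mu=\mu(n,N,u)=u+iv(n,N,u)$, and $$f_{n,N}^{(1)}(u)=\frac{\sin\frac{(n+1)\mu}{2}}{\sin\frac{(n-1)\mu}{2}},\qquad f_{n,N}^{(2)}(u)=\frac{\cos\frac{(n+1)\mu}{2}}{\cos\frac{(n-1)\mu}{2}}$$ (with removable singularities removed). The level curve is $L_{n,N}^{(k)}=\{f_{n,N}^{(k)}(u):u\in R(n,N)\}$,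 which is the set of all $\rho\in\mathbb{C}$ for which $K_n(\rho)$ has a type-$k$ eigenvalue of magnitude $N$; $B_n^{(k)}=L_{n,n}^{(k)}$ is the borderline curve. ''$L_{n,N}^{(k)}$ loops in a half-plane'' means that there is a nondegenerate parameter interval $[a,b]\subset R(n,N)$, $a<b$, with $f_{n,N}^{(k)}(a)=f_{n,N}^{(k)}(b)$ and $f_{n,N}^{(k)}([a,b])$ contained in that open half-plane; the image $f_{n,N}^{(k)}([a,b])$ is the loop and the common endpoint value is the self-intersection point. The loop with self-intersection point $\rho_{\rm upper}$ (respectively $\rho_{\rm lower}$) is the one traced between the two parameter values $-\frac{\pi}{2}\mp u_0(n,N)$ (respectively $\frac{\pi}{2}\mp u_0(n,N)$). For odd integers $n\ge3$, with $k=1$ if $n\in\{5,9,13,\ldots\}$ and $k=2$ if $n\in\{3,7,11,\ldots\}$, it is known (from earlier work) that $B_n^{(k)}$ has one cusp on the positive imaginary semi-axis and one on the negative imaginary semi-axis. In general, $B_n^{(k)}$ has a cusp at $\rho_c$ if and only if $K_n(\rho_c)$ has an (algebraically) double type-$k$ eigenvalue equal to $-n$. *)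

(* Defs.v *)
From Stdlib Require Export Reals Lra Lia Arith ClassicalEpsilon.
From Coquelicot Require Export Coquelicot.
Open Scope R_scope.

Fixpoint chebU (k : nat) (x : R) : R :=
  match k with
  | 0%nat => 1
  | S k' =>
      match k' with
      | 0%nat => 2 * x
      | S k'' => 2 * x * chebU k' x - chebU k'' x
      end
  end.

Lemma chebU_cos (k : nat) (u : R) :
  chebU k (cos u) * sin u = sin ((INR k + 1) * u).
Proof.
  assert (H : chebU k (cos u) * sin u = sin ((INR k + 1) * u) /\
              chebU (S k) (cos u) * sin u = sin ((INR (S k) + 1) * u)).
  { induction k as [|k [IH1 IH2]].
    - simpl. split.
      + rewrite Rmult_1_l. f_equal. ring.
      + replace ((1 + 1) * u) with (2 * u) by ring. rewrite sin_2a. ring.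
    - split; [exact IH2|].
      change (chebU (S (S k)) (cos u))
        with (2 * cos u * chebU (S k) (cos u) - chebU k (cos u)).
      replace ((2 * cos u * chebU (S k) (cos u) - chebU k (cos u)) * sin u)
        with (2 * cos u * (chebU (S k) (cos u) * sin u)
              - chebU k (cos u) * sin u) by ring.
      rewrite IH1, IH2, !S_INR.
      replace ((INR k + 1 + 1 + 1) * u) with ((INR k + 1 + 1) * u + u) by ring.
      replace ((INR k + 1) * u) with ((INR k + 1 + 1) * u - u) by ring.
      rewrite sin_plus, sin_minus. ring. }
  exact (proj1 H).
Qed.

Definition x0' (n : nat) : R :=
  epsilon (inhabits 0) (fun x =>
    cos (2 * PI / INR n) < x < cos (PI / INR n) /\
    Derive (chebU (n - 1)) x = 0).

Definition N_min (n : nat) : R := Rabs (chebU (n - 1) (x0' n)).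

Definition x0 (n : nat) (N : R) : R :=
  epsilon (inhabits 0) (fun x =>
    0 < x /\ -1 < x < 1 /\ Rabs (chebU (n - 1) x) = N).

Definition u0 (n : nat) (N : R) : R :=
  if Req_EM_T N (INR n) then 0 else acos (x0 n N).

Definition Rset (n : nat) (N u : R) : Prop :=
  (- PI + u0 n N <= u <= - u0 n N) \/ (u0 n N <= u <= PI - u0 n N).

Definition v (n : nat) (N u : R) : R :=
  epsilon (inhabits 0) (fun w =>
    0 <= w /\
    (sinh (INR n * w)) ^ 2 - N ^ 2 * (sinh w) ^ 2
      = N ^ 2 * (sin u) ^ 2 - (sin (INR n * u)) ^ 2).

Definition mu (n : nat) (N u : R) : C := (u, v n N u).

(* Real and imaginary parts of sin (x + iy) and cos (x + iy), from the
   addition formulas with cos (iy) = cosh y and sin (iy) = i sinh y. *)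
Definition Csin (z : C) : C :=
  (sin (Re z) * cosh (Im z), cos (Re z) * sinh (Im z)).
Definition Ccos (z : C) : C :=
  (cos (Re z) * cosh (Im z), - (sin (Re z) * sinh (Im z))).

Inductive eigtype : Set := type1 | type2.

Definition trig (k : eigtype) : C -> C :=
  match k with type1 => Csin | type2 => Ccos end.

Definition f_num (k : eigtype) (n : nat) (N u : R) : C :=
  trig k (RtoC ((INR n + 1) / 2) * mu n N u)%C.
Definition f_den (k : eigtype) (n : nat) (N u : R) : C :=
  trig k (RtoC ((INR n - 1) / 2) * mu n N u)%C.

(* Where the denominator vanishes, the value is the limit of the quotient
   along the parameter set (removable singularity). *)
Definition f (k : eigtype) (n : nat) (N u : R) : C :=
  if excluded_middle_informative (f_den k n N u = RtoC 0) then
    epsilon (inhabits (RtoC 0)) (fun l : C =>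
      filterlim (fun t => (f_num k n N t / f_den k n N t)%C)
        (within (Rset n N) (locally' u)) (locally l))
  else (f_num k n N u / f_den k n N u)%C.

Definition level_curve (k : eigtype) (n : nat) (N : R) (rho : C) : Prop :=
  exists u, Rset n N u /\ rho = f k n N u.

Definition upper (rho : C) : Prop := 0 < Im rho.
Definition lower (rho : C) : Prop := Im rho < 0.

Definition loop_image (k : eigtype) (n : nat) (N a b : R) (rho : C) : Prop :=
  exists u, a <= u <= b /\ rho = f k n N u.

Definition is_loop (k : eigtype) (n : nat) (N : R) (H : C -> Prop) (a b : R)
  : Prop :=
  a < b /\
  (forall u, a <= u <= b -> Rset n N u) /\
  f k n N a = f k n N b /\
  (forall rho, loop_image k n N a b rho -> H rho).

Definition loops_in (k : eigtype) (n : nat) (N : R) (H : C -> Prop) : Prop :=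
  exists a b, is_loop k n N H a b.

Definition borderline (k : eigtype) (n : nat) : C -> Prop :=
  level_curve k n (INR n).

(* The limit of the normalized secant is two-sided: the branches t < u and
   t > u leave the point along the same half-tangent, of direction d.  At a
   regular point the two one-sided limits are opposite instead. *)
Definition cusp (k : eigtype) (n : nat) (rho : C) : Prop :=
  borderline k n rho /\
  exists u, locally u (Rset n (INR n)) /\ rho = f k n (INR n) u /\
    exists d : C, Cmod d = 1 /\
      filterlim
        (fun t => ((f k n (INR n) t - rho) / RtoC (Cmod (f k n (INR n) t - rho)))%C)
        (locally' u) (locally d).

(* The loop of level N is traced over [a N, b N]. *)
Definition shrinks_to (k : eigtype) (n : nat) (a b : R -> R) (rho_c : C)
  : Prop :=
  forall eps : posreal,
    at_left (INR n) (fun N =>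
      forall rho, loop_image k n N (a N) (b N) rho ->
        Cmod (rho - rho_c)%C < eps).

(* Main.v *)
Require Import Defs.

(** The whole argument takes place near the imaginary axis.  Put
    u = - sg * PI / 2 + w with sg = 1 for the upper and sg = -1 for the lower
    half-plane, and h = v n N u.  For the pairs (n, k) of the theorem the point
    of the curve is sg * (X + iY), where [f_axis]

      X = (sin w cosh nh - sin nw cosh h) / D,
      Y = (cos w sinh nh - cos nw sinh h) / D,
      D = cosh (n-1)h - cos (n-1)w > 0,

    and the level equation becomes [level_axis]

      cosh^2 nh - N^2 cosh^2 h = sin^2 nw - N^2 sin^2 w.

    Loops.  At w = u0 and w = - u0 one has sin nw = N sin w, so the level
    equation gives cosh nh = N cosh h and X vanishes; since Y is even in w the
    two values agree.  In between, Y > 0 because cos nw <= N cos w while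
    sinh nh > N sinh h.  This needs h > 0 along the loop, that is
    |sin nu| < N |sin u| there, and needs the loop to fit into the parameter
    set, that is u0 <= PI / 4.  Both follow from N > N_min through the bound
    |sin nu| <= N_min sin u on [PI / 4, PI / 2] [N_min_bound_quarter].

    Limit.  f is jointly continuous in (N, u) where the level equation has a
    positive root [lim_f], and u0 tends to 0 because
    N <= (n - 1) cos u0 + 1 [u0_small].  So the loops shrink to the point with
    N = n, w = 0.

    Cusp.  At that point cosh nh = n cosh h.  For N = n, factoring the
    level equation shows that cosh nh - n cosh h is a multiple of
    n sin w - sin nw = o(w^2); hence h is constant up to o(w^2)
    [height_flat].  Expanding with h frozen, X = o(w^2), while
    Y - Y(0) = l w^2 + o(w^2) with l = - n Y(0) / 2 < 0 [axis_expansion].  Both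
    branches therefore leave vertically to the same side, which is a cusp.

    Uniqueness.  For N = n, X = 0 and the level equation force
    sin nw = n sin w up to sign, so sin w = 0 [axis_re_zero]: the curve meets
    the imaginary axis only at w = 0 in the given half-plane.  The one parameter
    value where these formulas break down is u = 0, and there f is real
    [Im_f_0]. *)

(** * Hyperbolic and trigonometric estimates *)

Lemma sinh_plus (x y : R) : sinh (x + y) = sinh x * cosh y + cosh x * sinh y.
Proof.
  unfold sinh, cosh.
  rewrite Ropp_plus_distr, !exp_plus. field.
Qed.

Lemma cosh_plus (x y : R) : cosh (x + y) = cosh x * cosh y + sinh x * sinh y.
Proof.
  unfold sinh, cosh.
  rewrite Ropp_plus_distr, !exp_plus. field.
Qed.

Lemma sinh_opp (x : R) : sinh (- x) = - sinh x.
Proof. unfold sinh. rewrite Ropp_involutive. field. Qed.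

Lemma cosh_opp (x : R) : cosh (- x) = cosh x.
Proof. unfold cosh. rewrite Ropp_involutive. field. Qed.

Lemma sinh_minus (x y : R) : sinh (x - y) = sinh x * cosh y - cosh x * sinh y.
Proof. unfold Rminus. rewrite sinh_plus, sinh_opp, cosh_opp. ring. Qed.

Lemma cosh_minus (x y : R) : cosh (x - y) = cosh x * cosh y - sinh x * sinh y.
Proof. unfold Rminus. rewrite cosh_plus, sinh_opp, cosh_opp. ring. Qed.

Lemma cosh_sqr (x : R) : (cosh x) ^ 2 = 1 + (sinh x) ^ 2.
Proof.
  generalize (cosh_minus x x).
  replace (x - x) with 0 by ring. rewrite cosh_0. lra.
Qed.

Lemma sinh_pos (x : R) : 0 < x -> 0 < sinh x.
Proof. intros H. rewrite <- sinh_0. now apply sinh_lt. Qed.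

Lemma sinh_nonneg (x : R) : 0 <= x -> 0 <= sinh x.
Proof.
  intros [H|<-]; [left; now apply sinh_pos | rewrite sinh_0; lra].
Qed.

Lemma cosh_pos (x : R) : 0 < cosh x.
Proof. unfold cosh. generalize (exp_pos x) (exp_pos (- x)). lra. Qed.

Lemma cosh_ge_1 (x : R) : 1 <= cosh x.
Proof.
  generalize (cosh_sqr x) (cosh_pos x) (pow2_ge_0 (sinh x)). nra.
Qed.

Lemma cosh_gt_1 (x : R) : 0 < x -> 1 < cosh x.
Proof.
  intros H. generalize (cosh_sqr x) (cosh_pos x) (sinh_pos x H). nra.
Qed.

Lemma sin_sqr (x : R) : (sin x) ^ 2 = 1 - (cos x) ^ 2.
Proof. generalize (sin2_cos2 x). unfold Rsqr. lra. Qed.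

Lemma cosh_mult_ge (n : nat) (x : R) :
  (1 <= n)%nat -> 0 <= x -> cosh x <= cosh (INR n * x).
Proof.
  intros Hn Hx. destruct n as [|m]; [lia|].
  rewrite S_INR. replace ((INR m + 1) * x) with (INR m * x + x) by ring.
  rewrite cosh_plus.
  assert (0 <= INR m * x) by (apply Rmult_le_pos; [apply pos_INR|lra]).
  generalize (cosh_ge_1 (INR m * x)) (sinh_nonneg _ H) (sinh_nonneg _ Hx) (cosh_pos x).
  nra.
Qed.

(** The factor cosh x, rather than the bound n sinh x alone, is what makes
    sinh^2 nx - n^2 sinh^2 x unbounded, so that the level equation has a root
    even at N = n. *)
Lemma sinh_mult_ge (n : nat) (x : R) :
  (2 <= n)%nat -> 0 <= x -> INR n * sinh x * cosh x <= sinh (INR n * x).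
Proof.
  intros Hn Hx. induction Hn as [|m Hm IH].
  - simpl. replace ((1 + 1) * x) with (x + x) by ring. rewrite sinh_plus. lra.
  - rewrite S_INR. replace ((INR m + 1) * x) with (INR m * x + x) by ring.
    rewrite sinh_plus.
    assert (Hc : cosh x <= cosh (INR m * x)) by (apply cosh_mult_ge; [lia|lra]).
    generalize (cosh_ge_1 x) (sinh_nonneg _ Hx). intros H1 H2.
    assert (0 <= INR m) by apply pos_INR.
    assert (INR m * sinh x * cosh x * 1 <= sinh (INR m * x) * cosh x).
    { apply Rmult_le_compat; try lra.
      apply Rmult_le_pos; [apply Rmult_le_pos; lra|lra]. }
    nra.
Qed.

Lemma sinh_mult_gt (n : nat) (x : R) :
  (2 <= n)%nat -> 0 < x -> INR n * sinh x < sinh (INR n * x).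
Proof.
  intros Hn Hx.
  generalize (sinh_mult_ge n x Hn (Rlt_le _ _ Hx)) (cosh_gt_1 _ Hx) (sinh_pos _ Hx).
  assert (0 < INR n) by (apply lt_0_INR; lia). intros.
  assert (0 < INR n * sinh x) by (apply Rmult_lt_0_compat; lra). nra.
Qed.

Lemma sinh_sqr_minus (x y : R) :
  (sinh x) ^ 2 - (sinh y) ^ 2 = sinh (x + y) * sinh (x - y).
Proof.
  rewrite sinh_plus, sinh_minus.
  generalize (cosh_sqr x) (cosh_sqr y). intros Hx Hy.
  replace ((sinh x * cosh y + cosh x * sinh y) * (sinh x * cosh y - cosh x * sinh y))
    with ((sinh x)^2 * (cosh y)^2 - (cosh x)^2 * (sinh y)^2) by ring.
  rewrite Hx, Hy. ring.
Qed.

Lemma abs_sin_mult_le (k : nat) (u : R) : Rabs (sin (INR k * u)) <= INR k * Rabs (sin u).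
Proof.
  induction k as [|k IH].
  - simpl. rewrite Rmult_0_l, sin_0, Rabs_R0. lra.
  - rewrite S_INR. replace ((INR k + 1) * u) with (INR k * u + u) by ring.
    rewrite sin_plus.
    eapply Rle_trans; [apply Rabs_triang|]. rewrite !Rabs_mult.
    assert (A : forall x, Rabs (cos x) <= 1)
      by (intros x; apply Rabs_le; generalize (COS_bound x); lra).
    generalize (A u) (A (INR k * u)) (Rabs_pos (sin u)) (Rabs_pos (sin (INR k * u)))
      (Rabs_pos (cos u)) (Rabs_pos (cos (INR k * u))). nra.
Qed.

(** Expand sin ((n-1)u + u) and bound the first term by
    [abs_sin_mult_le].  Keeping cos u makes the bound strictly better than
    n |sin u| away from the multiples of PI, and it also controls how fast u0
    tends to 0. *)
Lemma abs_sin_mult_le_cos (n : nat) (u : R) :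
  (1 <= n)%nat ->
  Rabs (sin (INR n * u)) <= ((INR n - 1) * Rabs (cos u) + 1) * Rabs (sin u).
Proof.
  intros Hn. destruct n as [|k]; [lia|].
  rewrite S_INR. replace ((INR k + 1) * u) with (INR k * u + u) by ring.
  rewrite sin_plus.
  eapply Rle_trans; [apply Rabs_triang|]. rewrite !Rabs_mult.
  assert (A : Rabs (cos (INR k * u)) <= 1)
    by (apply Rabs_le; generalize (COS_bound (INR k * u)); lra).
  generalize (abs_sin_mult_le k u) (Rabs_pos (sin u)) (Rabs_pos (cos u)). nra.
Qed.

Lemma abs_sin_mult_lt (n : nat) (u : R) :
  (2 <= n)%nat -> sin u <> 0 -> Rabs (sin (INR n * u)) < INR n * Rabs (sin u).
Proof.
  intros Hn Hu.
  assert (Hs := Rabs_pos_lt _ Hu).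
  assert (Hc : Rabs (cos u) < 1).
  { apply Rabs_def1; generalize (sin_sqr u);
    assert (0 < sin u ^ 2) by (apply pow2_gt_0; assumption); nra. }
  assert (1 < INR n) by (apply lt_1_INR; lia).
  generalize (abs_sin_mult_le_cos n u ltac:(lia)). intros H1.
  assert ((INR n - 1) * Rabs (cos u) + 1 < INR n) by nra.
  nra.
Qed.

(** * The positive root of the level equation *)

(** The level equation reads lift n N v = gap n N u: the left side depends on
    the height v only and the right side on the angle u only. *)
Definition lift (n : nat) (N w : R) : R := (sinh (INR n * w)) ^ 2 - N ^ 2 * (sinh w) ^ 2.
Definition gap (n : nat) (N u : R) : R := N ^ 2 * (sin u) ^ 2 - (sin (INR n * u)) ^ 2.

(** By [sinh_sqr_minus] the increment of sinh^2 nx factors into two sinh of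
    multiples of n, each of which exceeds n (hence N) times the corresponding
    factor of the increment of sinh^2 x. *)
Lemma lift_lt (n : nat) (N a b : R) :
  (2 <= n)%nat -> 0 <= N <= INR n -> 0 <= a < b -> lift n N a < lift n N b.
Proof.
  intros Hn HN Hab. unfold lift.
  assert (E1 := sinh_sqr_minus (INR n * b) (INR n * a)).
  assert (E2 := sinh_sqr_minus b a).
  replace (INR n * b + INR n * a) with (INR n * (b + a)) in E1 by ring.
  replace (INR n * b - INR n * a) with (INR n * (b - a)) in E1 by ring.
  assert (H1 := sinh_mult_gt n (b + a) Hn ltac:(lra)).
  assert (H2 := sinh_mult_gt n (b - a) Hn ltac:(lra)).
  assert (P1 := sinh_pos (b + a) ltac:(lra)).
  assert (P2 := sinh_pos (b - a) ltac:(lra)).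
  assert (Q1 : N * sinh (b + a) <= INR n * sinh (b + a)) by (apply Rmult_le_compat_r; lra).
  assert (Q2 : N * sinh (b - a) <= INR n * sinh (b - a)) by (apply Rmult_le_compat_r; lra).
  assert (0 <= N * sinh (b + a)) by (apply Rmult_le_pos; lra).
  assert (0 <= N * sinh (b - a)) by (apply Rmult_le_pos; lra).
  assert (N * sinh (b + a) * (N * sinh (b - a)) <
          sinh (INR n * (b + a)) * sinh (INR n * (b - a))).
  { apply Rmult_le_0_lt_compat; lra. }
  assert (N ^ 2 * (sinh b ^ 2 - sinh a ^ 2) < sinh (INR n * b) ^ 2 - sinh (INR n * a) ^ 2).
  { rewrite E1, E2. nra. }
  lra.
Qed.

Lemma continuity_lift (n : nat) (N : R) : continuity (lift n N).
Proof.
  intros x. unfold lift.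
  apply derivable_continuous_pt.
  apply ex_derive_Reals_0. unfold sinh. auto_derive. trivial.
Qed.

Lemma lift_root_ex (n : nat) (N u : R) :
  (2 <= n)%nat -> 0 <= N <= INR n -> 0 <= gap n N u ->
  exists w, 0 <= w /\ lift n N w = gap n N u.
Proof.
  intros Hn HN Hg.
  assert (L0 : lift n N 0 = 0).
  { unfold lift. rewrite Rmult_0_r, sinh_0. ring. }
  (* The point where sinh w = 1 already lies above the target, since there
     sinh (n w) >= n sinh w cosh w with cosh w ^ 2 = 2. *)
  set (w1 := arcsinh 1).
  assert (Sw : sinh w1 = 1) by apply sinh_arcsinh.
  assert (P1 : 0 <= w1).
  { apply Rnot_lt_le. intros H. apply sinh_lt in H. rewrite sinh_0 in H. lra. }
  assert (L1 : gap n N u <= lift n N w1).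
  { unfold lift, gap.
    assert (H := sinh_mult_ge n w1 Hn P1).
    assert (C1 := cosh_sqr w1). assert (C2 := cosh_pos w1).
    rewrite Sw in *.
    assert (0 < INR n) by (apply lt_0_INR; lia).
    assert (0 <= INR n * 1 * cosh w1)
      by (apply Rmult_le_pos; [apply Rmult_le_pos; lra|lra]).
    assert ((INR n * 1 * cosh w1) ^ 2 <= sinh (INR n * w1) ^ 2) by (apply pow_incr; lra).
    assert (N ^ 2 <= INR n ^ 2) by (apply pow_incr; lra).
    assert (sin u ^ 2 <= 1) by (rewrite sin_sqr; generalize (pow2_ge_0 (cos u)); lra).
    generalize (pow2_ge_0 (sin (INR n * u))) (pow2_ge_0 N). intros.
    replace ((INR n * 1 * cosh w1) ^ 2) with (INR n ^ 2 * cosh w1 ^ 2) in * by ring.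
    rewrite C1 in *. nra. }
  destruct (IVT_gen (lift n N) 0 w1 (gap n N u) (continuity_lift n N)) as [w [Hw Ew]].
  { rewrite L0. unfold Rmin, Rmax. repeat destruct Rle_dec; lra. }
  exists w. split; [|exact Ew]. revert Hw. unfold Rmin. destruct Rle_dec; lra.
Qed.

Lemma v_spec (n : nat) (N u : R) :
  (2 <= n)%nat -> 0 <= N <= INR n -> 0 <= gap n N u ->
  0 <= v n N u /\ lift n N (v n N u) = gap n N u.
Proof.
  intros Hn HN Hg. unfold v. apply epsilon_spec. now apply lift_root_ex.
Qed.

(** On the region gap > 0 the denominator of f cannot vanish, and f is given by
    its Cartesian form. *)
Lemma v_pos (n : nat) (N u : R) :
  (2 <= n)%nat -> 0 <= N <= INR n -> 0 < gap n N u -> 0 < v n N u.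
Proof.
  intros Hn HN Hg.
  destruct (v_spec n N u Hn HN (Rlt_le _ _ Hg)) as [[H|H] E]; [exact H|].
  exfalso. rewrite <- H in E. unfold lift in E. rewrite Rmult_0_r, sinh_0 in E. lra.
Qed.

Lemma lift_lt_reg (n : nat) (N a b : R) :
  (2 <= n)%nat -> 0 <= N <= INR n -> 0 <= b -> lift n N a < lift n N b -> a < b.
Proof.
  intros Hn HN Hb H. destruct (Rlt_le_dec a b) as [|Hle]; [assumption|exfalso].
  destruct Hle as [Hlt| ->]; [|lra].
  generalize (lift_lt n N b a Hn HN (conj Hb Hlt)). lra.
Qed.

(** * Limits along a filter *)

Tactic Notation "ball_abs" :=
  unfold ball; simpl; unfold AbsRing_ball, minus, plus, opp, abs; simpl.
Tactic Notation "ball_abs" "in" hyp(H) :=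
  unfold ball in H; simpl in H;
  unfold AbsRing_ball, minus, plus, opp, abs in H; simpl in H.
Tactic Notation "ball_abs" "in" "*" :=
  unfold ball in *; simpl in *;
  unfold AbsRing_ball, minus, plus, opp, abs in *; simpl in *.

Lemma lim_plus {T} {F : (T -> Prop) -> Prop} {FF : Filter F} (g h : T -> R) (a b : R) :
  filterlim g F (locally a) -> filterlim h F (locally b) ->
  filterlim (fun t => g t + h t) F (locally (a + b)).
Proof.
  intros Hg Hh.
  exact (filterlim_comp_2 g h Rplus Hg Hh (@filterlim_plus R_AbsRing R_NormedModule a b)).
Qed.

Lemma lim_mult {T} {F : (T -> Prop) -> Prop} {FF : Filter F} (g h : T -> R) (a b : R) :
  filterlim g F (locally a) -> filterlim h F (locally b) ->
  filterlim (fun t => g t * h t) F (locally (a * b)).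
Proof.
  intros Hg Hh.
  exact (filterlim_comp_2 g h Rmult Hg Hh (@filterlim_mult R_AbsRing a b)).
Qed.

Lemma lim_const {T} {F : (T -> Prop) -> Prop} {FF : Filter F} (a : R) :
  filterlim (fun _ : T => a) F (locally a).
Proof. apply filterlim_const. Qed.

Lemma lim_comp {T} {F : (T -> Prop) -> Prop} {FF : Filter F} (g : T -> R) (h : R -> R) (a : R) :
  continuous h a -> filterlim g F (locally a) ->
  filterlim (fun t => h (g t)) F (locally (h a)).
Proof. intros Hh Hg. exact (filterlim_comp _ _ _ g h F _ _ Hg Hh). Qed.

Lemma lim_minus {T} {F : (T -> Prop) -> Prop} {FF : Filter F} (g h : T -> R) (a b : R) :
  filterlim g F (locally a) -> filterlim h F (locally b) ->
  filterlim (fun t => g t - h t) F (locally (a - b)).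
Proof.
  intros Hg Hh. apply lim_plus; [exact Hg|].
  apply (lim_comp h Ropp); [|exact Hh]. apply (continuous_opp (fun x : R => x)), continuous_id.
Qed.

Lemma lim_pow {T} {F : (T -> Prop) -> Prop} {FF : Filter F} (g : T -> R) (a : R) (k : nat) :
  filterlim g F (locally a) -> filterlim (fun t => g t ^ k) F (locally (a ^ k)).
Proof.
  intros Hg. induction k as [|k IH]; simpl; [apply lim_const|now apply lim_mult].
Qed.

Lemma lim_div {T} {F : (T -> Prop) -> Prop} {FF : Filter F} (g h : T -> R) (a b : R) :
  b <> 0 -> filterlim g F (locally a) -> filterlim h F (locally b) ->
  filterlim (fun t => g t / h t) F (locally (a / b)).
Proof.
  intros Hb Hg Hh. apply lim_mult; [exact Hg|].
  apply (lim_comp h Rinv); [|exact Hh]. now apply continuous_Rinv.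
Qed.

Lemma continuous_sin_R (x : R) : continuous sin x.
Proof. apply continuity_pt_filterlim, continuity_sin. Qed.
Lemma continuous_cos_R (x : R) : continuous cos x.
Proof. apply continuity_pt_filterlim, continuity_cos. Qed.
Lemma continuous_sinh (x : R) : continuous sinh x.
Proof.
  apply continuity_pt_filterlim, derivable_continuous_pt, derivable_pt_sinh.
Qed.
Lemma continuous_cosh (x : R) : continuous cosh x.
Proof.
  apply continuity_pt_filterlim, derivable_continuous_pt, derivable_pt_cosh.
Qed.

Lemma lim_pair {T} {F : (T -> Prop) -> Prop} {FF : Filter F} (g h : T -> R) (a b : R) :
  filterlim g F (locally a) -> filterlim h F (locally b) ->
  filterlim (fun t => (g t, h t) : C) F (locally ((a, b) : C)).
Proof.
  intros Hg Hh. apply filterlim_locally. intros eps.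
  assert (G := proj1 (filterlim_locally g a) Hg eps).
  assert (H := proj1 (filterlim_locally h b) Hh eps).
  generalize (filter_and _ _ G H). apply filter_imp. intros t [A B]. split; assumption.
Qed.

Lemma lim_fst {T} {F : (T -> Prop) -> Prop} {FF : Filter F} (g : T -> C) (l : C) :
  filterlim g F (locally l) -> filterlim (fun t => fst (g t)) F (locally (fst l)).
Proof.
  intros Hg. apply filterlim_locally. intros eps.
  generalize (proj1 (filterlim_locally g l) Hg eps). apply filter_imp. intros t [A B]. exact A.
Qed.

Lemma lim_snd {T} {F : (T -> Prop) -> Prop} {FF : Filter F} (g : T -> C) (l : C) :
  filterlim g F (locally l) -> filterlim (fun t => snd (g t)) F (locally (snd l)).
Proof.
  intros Hg. apply filterlim_locally. intros eps.
  generalize (proj1 (filterlim_locally g l) Hg eps). apply filter_imp. intros t [A B]. exact B.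
Qed.

Lemma lim_lt {T} {F : (T -> Prop) -> Prop} {FF : Filter F} (g h : T -> R) (a b : R) :
  filterlim g F (locally a) -> filterlim h F (locally b) -> a < b ->
  F (fun t => g t < h t).
Proof.
  intros Hg Hh Hab.
  assert (Hp : 0 < (b - a) / 2) by lra.
  assert (G := proj1 (filterlim_locally g a) Hg (mkposreal _ Hp)).
  assert (H := proj1 (filterlim_locally h b) Hh (mkposreal _ Hp)).
  generalize (filter_and _ _ G H). apply filter_imp. intros t [A B].
  ball_abs in A. ball_abs in B.
  apply Rabs_def2 in A. apply Rabs_def2 in B. lra.
Qed.

Lemma lim_squeeze_abs {T} {F : (T -> Prop) -> Prop} {FF : Filter F} (g h : T -> R) :
  F (fun t => Rabs (g t) <= h t) -> filterlim h F (locally 0) -> filterlim g F (locally 0).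
Proof.
  intros Hgh Hh. apply filterlim_locally. intros eps.
  generalize (filter_and _ _ Hgh (proj1 (filterlim_locally h 0) Hh eps)).
  apply filter_imp. intros t [A B].
  ball_abs in *.
  apply Rabs_def2 in B. rewrite Ropp_0, Rplus_0_r in *. lra.
Qed.

Lemma lim_gap {T} {F : (T -> Prop) -> Prop} {FF : Filter F} (n : nat) (Nf uf : T -> R) (N u : R) :
  filterlim Nf F (locally N) -> filterlim uf F (locally u) ->
  filterlim (fun t => gap n (Nf t) (uf t)) F (locally (gap n N u)).
Proof.
  intros LN Lu. unfold gap. apply lim_minus.
  - apply lim_mult; [now apply lim_pow|]. apply lim_pow.
    apply (lim_comp uf sin); [apply continuous_sin_R|exact Lu].
  - apply lim_pow. apply (lim_comp (fun t => INR n * uf t) sin); [apply continuous_sin_R|].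
    apply lim_mult; [apply lim_const|exact Lu].
Qed.

(** As lift is strictly increasing in the height, v lies between v n N u - eps and
    v n N u + eps as soon as gap lies between the values of lift at these two
    fixed heights, and that is an open condition on (N, u).  An arbitrary filter
    covers continuity in u at fixed N as well as joint continuity in (N, u). *)
Lemma lim_v {T} {F : (T -> Prop) -> Prop} {FF : Filter F} (n : nat) (Nf uf : T -> R) (N u : R) :
  (2 <= n)%nat -> 0 <= N <= INR n -> 0 <= gap n N u ->
  filterlim Nf F (locally N) -> filterlim uf F (locally u) ->
  F (fun t => 0 <= Nf t <= INR n /\ 0 <= gap n (Nf t) (uf t)) ->
  filterlim (fun t => v n (Nf t) (uf t)) F (locally (v n N u)).
Proof.
  intros Hn HN Hg LN Lu Hev.
  destruct (v_spec n N u Hn HN Hg) as [V0 VE].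
  assert (Lgap := lim_gap n Nf uf N u LN Lu).
  assert (Llift : forall x, filterlim (fun t => lift n (Nf t) x) F (locally (lift n N x))).
  { intros x. unfold lift. apply lim_minus; [apply lim_const|].
    apply lim_mult; [now apply lim_pow|apply lim_const]. }
  apply filterlim_locally. intros eps. assert (He := cond_pos eps).
  assert (Up : F (fun t => v n (Nf t) (uf t) < v n N u + eps)).
  { assert (H := lim_lt _ _ _ _ Lgap (Llift (v n N u + eps))
      ltac:(rewrite <- VE; apply lift_lt; auto; lra)).
    generalize (filter_and _ _ Hev H). apply filter_imp. intros t [[HNt Hgt] Hlt].
    destruct (v_spec n _ _ Hn HNt Hgt) as [_ Et].
    apply lift_lt_reg with n (Nf t); auto; lra. }
  assert (Lo : F (fun t => v n N u - eps < v n (Nf t) (uf t))).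
  { destruct (Rlt_le_dec (v n N u - eps) 0) as [Hneg|Hpos].
    - revert Hev. apply filter_imp. intros t [HNt Hgt].
      destruct (v_spec n _ _ Hn HNt Hgt) as [Vt _]. lra.
    - assert (H := lim_lt _ _ _ _ (Llift (v n N u - eps)) Lgap
        ltac:(rewrite <- VE; apply lift_lt; auto; lra)).
      generalize (filter_and _ _ Hev H). apply filter_imp. intros t [[HNt Hgt] Hlt].
      destruct (v_spec n _ _ Hn HNt Hgt) as [V1 Et].
      apply lift_lt_reg with n (Nf t); auto; lra. }
  generalize (filter_and _ _ Up Lo). apply filter_imp. intros t [A B].
  ball_abs.
  apply Rabs_def1; lra.
Qed.

(** * Real and imaginary parts of the level curve *)

(** The product formulas for sines and for cosines differ only by this sign,
    which lets both types share one Cartesian form. *)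
Definition sgn (k : eigtype) : R := match k with type1 => 1 | type2 => -1 end.

Lemma sgn_cases (k : eigtype) : sgn k = 1 \/ sgn k = -1.
Proof. destruct k; simpl; auto. Qed.

Lemma cartesian_den_pos (k : eigtype) (n : nat) (N u : R) :
  (2 <= n)%nat -> 0 < v n N u ->
  0 < cosh ((INR n - 1) * v n N u) - sgn k * cos ((INR n - 1) * u).
Proof.
  intros Hn Hv.
  assert (1 < INR n) by (apply lt_1_INR; lia).
  assert (H1 : 1 < cosh ((INR n - 1) * v n N u)) by (apply cosh_gt_1, Rmult_lt_0_compat; lra).
  generalize (COS_bound ((INR n - 1) * u)).
  destruct (sgn_cases k) as [-> | ->]; lra.
Qed.

(** The factors 2 match the product-to-sum formulas applied to P, Q and E. *)
Lemma Cdiv_cartesian (a b c d P Q E : R) :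
  0 < E -> 2 * (a * c + b * d) = P -> 2 * (b * c - a * d) = Q -> 2 * (c ^ 2 + d ^ 2) = E ->
  ((a, b) / (c, d))%C = (P / E, Q / E) /\ (c, d) <> RtoC 0.
Proof.
  intros HE HP HQ H. subst P Q. split.
  - unfold Cdiv, Cmult, Cinv; simpl fst; simpl snd.
    assert (c ^ 2 + d ^ 2 <> 0) by lra.
    rewrite <- H. f_equal; field; lra.
  - intros H0. injection H0 as -> ->. lra.
Qed.

(** Multiplying numerator and denominator of f by the conjugate of the
    denominator turns products of trigonometric functions of (n+1)/2 and (n-1)/2
    times the argument into sums with multiples n, 1 and n - 1. *)
Definition cartesian (k : eigtype) (n : nat) (u h : R) : C :=
  ((cos u * cosh (INR n * h) - sgn k * (cos (INR n * u) * cosh (h)))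
      / (cosh ((INR n - 1) * h) - sgn k * cos ((INR n - 1) * u)),
    (- (sin u * sinh (INR n * h)) + sgn k * (sin (INR n * u) * sinh (h)))
      / (cosh ((INR n - 1) * h) - sgn k * cos ((INR n - 1) * u))).

Lemma f_cartesian (k : eigtype) (n : nat) (N u : R) :
  (2 <= n)%nat -> 0 < v n N u ->
  f k n N u =
   cartesian k n u (v n N u).
Proof.
  intros Hn Hv. unfold cartesian.
  assert (HD := cartesian_den_pos k n N u Hn Hv).
  assert (E : (f_num k n N u / f_den k n N u)%C =
   ((cos u * cosh (INR n * v n N u) - sgn k * (cos (INR n * u) * cosh (v n N u)))
      / (cosh ((INR n - 1) * v n N u) - sgn k * cos ((INR n - 1) * u)),
    (- (sin u * sinh (INR n * v n N u)) + sgn k * (sin (INR n * u) * sinh (v n N u)))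
      / (cosh ((INR n - 1) * v n N u) - sgn k * cos ((INR n - 1) * u))) /\
     f_den k n N u <> RtoC 0).
  { unfold f_num, f_den, mu. set (h := v n N u) in *.
    assert (MA : forall a : R, (RtoC a * (u, h))%C = (a * u, a * h)).
    { intros a. unfold Cmult, RtoC; simpl. f_equal; ring. }
    rewrite !MA. clear MA.
    set (p := (INR n + 1) / 2 * u) in *. set (q := (INR n - 1) / 2 * u) in *.
    set (r := (INR n + 1) / 2 * h) in *. set (s := (INR n - 1) / 2 * h) in *.
    replace ((INR n - 1) * u) with (q + q) in * by (unfold q; field).
    replace ((INR n - 1) * h) with (s + s) in * by (unfold s; field).
    replace (INR n * u) with (p + q) by (unfold p, q; field).
    replace (INR n * h) with (r + s) by (unfold r, s; field).
    replace (cos u) with (cos (p - q)) by (f_equal; unfold p, q; field).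
    replace (sin u) with (sin (p - q)) by (f_equal; unfold p, q; field).
    replace (cosh h) with (cosh (r - s)) by (f_equal; unfold r, s; field).
    replace (sinh h) with (sinh (r - s)) by (f_equal; unfold r, s; field).
    assert (C2 := cosh_sqr s). assert (S2 := sin_sqr q).
    rewrite cosh_plus, cos_plus in HD.
    rewrite !cosh_plus, !cos_plus, !sinh_plus, !sin_plus,
      !cosh_minus, !cos_minus, !sinh_minus, !sin_minus.
    clearbody h p q r s.
    destruct k; simpl trig; simpl sgn in *; unfold Csin, Ccos; simpl Re; simpl Im;
      (apply Cdiv_cartesian; [exact HD | ring | ring |]).
    - transitivity (2 * (sin q ^ 2 * cosh s ^ 2 + cos q ^ 2 * sinh s ^ 2)); [ring|].
      transitivity (cosh s ^ 2 + sinh s ^ 2 - (cos q ^ 2 - sin q ^ 2)); [|ring].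
      rewrite C2, S2. ring.
    - transitivity (2 * (cos q ^ 2 * cosh s ^ 2 + sin q ^ 2 * sinh s ^ 2)); [ring|].
      transitivity (cosh s ^ 2 + sinh s ^ 2 + (cos q ^ 2 - sin q ^ 2)); [|ring].
      rewrite C2, S2. ring. }
  unfold f. destruct (excluded_middle_informative (f_den k n N u = RtoC 0)) as [H|H].
  - elim (proj2 E H).
  - exact (proj1 E).
Qed.

(** * The curve near the imaginary axis *)

Definition admissible (k : eigtype) (n : nat) : Prop :=
  (k = type1 /\ (n mod 4 = 1)%nat) \/ (k = type2 /\ (n mod 4 = 3)%nat).

(** With w the offset of u from - sg * PI / 2, the curve point is sg times
    (axis_re + i axis_im) / axis_den, for both types and both signs sg. *)
Definition axis_den (n : nat) (w h : R) : R :=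
  cosh ((INR n - 1) * h) - cos ((INR n - 1) * w).
Definition axis_re (n : nat) (w h : R) : R :=
  sin w * cosh (INR n * h) - sin (INR n * w) * cosh h.
Definition axis_im (n : nat) (w h : R) : R :=
  cos w * sinh (INR n * h) - cos (INR n * w) * sinh h.

Lemma axis_den_pos (n : nat) (w h : R) : (2 <= n)%nat -> 0 < h -> 0 < axis_den n w h.
Proof.
  intros Hn Hh. unfold axis_den.
  assert (1 < INR n) by (apply lt_1_INR; lia).
  assert (H1 : 1 < cosh ((INR n - 1) * h)) by (apply cosh_gt_1, Rmult_lt_0_compat; lra).
  generalize (COS_bound ((INR n - 1) * w)). lra.
Qed.

(** The residue of n modulo 4 fixes n PI / 2 modulo 2 PI, and the sign that
    it produces is exactly sgn k.  This is where the choice of the type k by the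
    class of n enters. *)
Lemma shifted_multiples (k : eigtype) (n : nat) (sg w : R) :
  admissible k n -> sg = 1 \/ sg = -1 ->
  let u := - sg * (PI / 2) + w in
  sgn k * cos (INR n * u) = sg * sin (INR n * w) /\
  sgn k * sin (INR n * u) = - sg * cos (INR n * w) /\
  sgn k * cos ((INR n - 1) * u) = cos ((INR n - 1) * w).
Proof.
  intros Hk Hsg u.
  assert (Hm := Nat.div_mod n 4 ltac:(lia)).
  set (m := (n / 4)%nat) in *.
  assert (EN : INR n = 4 * INR m + INR (n mod 4)).
  { rewrite Hm at 1. rewrite plus_INR, mult_INR. simpl (INR 4). ring. }
  assert (A1 : forall x, sin (x + PI / 2) = cos x) by (intros; rewrite sin_plus, sin_PI2, cos_PI2; ring).
  assert (A2 : forall x, cos (x + PI / 2) = - sin x) by (intros; rewrite cos_plus, sin_PI2, cos_PI2; ring).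
  assert (A3 : forall x, sin (x - PI / 2) = - cos x) by (intros; rewrite sin_minus, sin_PI2, cos_PI2; ring).
  assert (A4 : forall x, cos (x - PI / 2) = sin x) by (intros; rewrite cos_minus, sin_PI2, cos_PI2; ring).
  destruct Hk as [[-> Hmod]|[-> Hmod]]; rewrite Hmod in EN; simpl INR in EN; simpl sgn;
    destruct Hsg as [-> | ->]; unfold u; clear u.
  - rewrite <- (sin_period (INR n * (- (1) * (PI / 2) + w)) m),
      <- (cos_period (INR n * (- (1) * (PI / 2) + w)) m),
      <- (cos_period ((INR n - 1) * (- (1) * (PI / 2) + w)) m).
    replace (INR n * (- (1) * (PI / 2) + w) + 2 * INR m * PI) with (INR n * w - PI / 2)
      by (rewrite EN; field).
    replace ((INR n - 1) * (- (1) * (PI / 2) + w) + 2 * INR m * PI) with ((INR n - 1) * w)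
      by (rewrite EN; field).
    rewrite A3, A4. repeat split; ring.
  - rewrite <- (sin_period (INR n * w) m),
      <- (cos_period (INR n * w) m),
      <- (cos_period ((INR n - 1) * w) m).
    replace (INR n * (- (-1) * (PI / 2) + w)) with (INR n * w + 2 * INR m * PI + PI / 2)
      by (rewrite EN; field).
    replace ((INR n - 1) * (- (-1) * (PI / 2) + w)) with ((INR n - 1) * w + 2 * INR m * PI)
      by (rewrite EN; field).
    rewrite A1, A2. repeat split; ring.
  - rewrite <- (sin_period (INR n * (- (1) * (PI / 2) + w)) (S m)),
      <- (cos_period (INR n * (- (1) * (PI / 2) + w)) (S m)),
      <- (cos_period ((INR n - 1) * (- (1) * (PI / 2) + w)) m).
    replace (INR n * (- (1) * (PI / 2) + w) + 2 * INR (S m) * PI) with (INR n * w + PI / 2)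
      by (rewrite EN, S_INR; field).
    replace ((INR n - 1) * (- (1) * (PI / 2) + w) + 2 * INR m * PI) with ((INR n - 1) * w - PI)
      by (rewrite EN; field).
    rewrite A1, A2, (cos_minus _ PI), cos_PI, sin_PI. repeat split; ring.
  - rewrite <- (sin_period (INR n * w) (S m)),
      <- (cos_period (INR n * w) (S m)),
      <- (cos_period ((INR n - 1) * w) m).
    replace (INR n * (- (-1) * (PI / 2) + w)) with (INR n * w + 2 * INR (S m) * PI - PI / 2)
      by (rewrite EN, S_INR; field).
    replace ((INR n - 1) * (- (-1) * (PI / 2) + w)) with ((INR n - 1) * w + 2 * INR m * PI + PI)
      by (rewrite EN; field).
    rewrite A3, A4, (cos_plus _ PI), cos_PI, sin_PI. repeat split; ring.
Qed.

Lemma sin_cos_shift (sg w : R) :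
  sg = 1 \/ sg = -1 ->
  cos (- sg * (PI / 2) + w) = sg * sin w /\ sin (- sg * (PI / 2) + w) = - sg * cos w.
Proof.
  intros [-> | ->]; rewrite cos_plus, sin_plus.
  - replace (- (1) * (PI / 2)) with (- (PI / 2)) by ring.
    rewrite cos_neg, sin_neg, cos_PI2, sin_PI2. split; ring.
  - replace (- (-1) * (PI / 2)) with (PI / 2) by ring.
    rewrite cos_PI2, sin_PI2. split; ring.
Qed.

Lemma gap_axis (k : eigtype) (n : nat) (N sg w : R) :
  admissible k n -> sg = 1 \/ sg = -1 ->
  gap n N (- sg * (PI / 2) + w) = N ^ 2 * cos w ^ 2 - cos (INR n * w) ^ 2.
Proof.
  intros Hk Hsg. unfold gap.
  destruct (shifted_multiples k n sg w Hk Hsg) as (_ & H2 & _).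
  destruct (sin_cos_shift sg w Hsg) as [_ H3].
  rewrite H3.
  assert (E : sin (INR n * (- sg * (PI / 2) + w)) ^ 2 = cos (INR n * w) ^ 2).
  { assert (E : (sgn k * sin (INR n * (- sg * (PI / 2) + w))) ^ 2
              = (- sg * cos (INR n * w)) ^ 2) by (rewrite H2; reflexivity).
    rewrite !Rpow_mult_distr in E.
    replace (sgn k ^ 2) with 1 in E by (destruct (sgn_cases k) as [-> | ->]; ring).
    replace ((- sg) ^ 2) with 1 in E by (destruct Hsg as [-> | ->]; ring). lra. }
  rewrite E. destruct Hsg as [-> | ->]; ring.
Qed.

Lemma f_axis (k : eigtype) (n : nat) (N sg w : R) :
  admissible k n -> sg = 1 \/ sg = -1 -> (2 <= n)%nat ->
  let h := v n N (- sg * (PI / 2) + w) in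
  0 < h ->
  f k n N (- sg * (PI / 2) + w) =
    (sg * (axis_re n w h / axis_den n w h), sg * (axis_im n w h / axis_den n w h)).
Proof.
  intros Hk Hsg Hn h Hh.
  destruct (shifted_multiples k n sg w Hk Hsg) as (H1 & H2 & H3).
  destruct (sin_cos_shift sg w Hsg) as [H4 H5].
  rewrite f_cartesian by assumption. fold h. unfold cartesian.
  rewrite <- !Rmult_assoc, H1, H2, H3, H4, H5.
  unfold axis_re, axis_im, axis_den.
  assert (HD := axis_den_pos n w h Hn Hh). unfold axis_den in HD.
  f_equal; field; lra.
Qed.

(** * The extremum N_min of the Chebyshev polynomial *)

Lemma ex_derive_chebU (k : nat) (x : R) : ex_derive (chebU k) x.
Proof.
  enough (H : ex_derive (chebU k) x /\ ex_derive (chebU (S k)) x) by apply H.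
  induction k as [|k [IH1 IH2]].
  - split; simpl; auto_derive; trivial.
  - split; [exact IH2|].
    apply (ex_derive_ext (fun t => 2 * t * chebU (S k) t - chebU k t)); [reflexivity|].
    auto_derive. repeat split; assumption.
Qed.

Lemma chebU_1 (k : nat) : chebU k 1 = INR k + 1.
Proof.
  enough (H : chebU k 1 = INR k + 1 /\ chebU (S k) 1 = INR (S k) + 1) by apply H.
  induction k as [|k [IH1 IH2]].
  - simpl. lra.
  - split; [exact IH2|].
    change (chebU (S (S k)) 1) with (2 * 1 * chebU (S k) 1 - chebU k 1).
    rewrite IH1, IH2, !S_INR. ring.
Qed.

Lemma chebU_pred_cos (n : nat) (u : R) :
  (1 <= n)%nat -> chebU (n - 1) (cos u) * sin u = sin (INR n * u).
Proof.
  intros Hn. rewrite chebU_cos, minus_INR by lia. f_equal. simpl. ring.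
Qed.

(** The numerator of the derivative of sin nu / sin u, which is
    U_{n-1}(cos u).  Its own derivative is a multiple of sin nu sin u and so has
    constant sign on each lobe of sin nu. *)
Definition wronsk (n : nat) (u : R) : R :=
  INR n * cos (INR n * u) * sin u - sin (INR n * u) * cos u.

Lemma is_derive_wronsk (n : nat) (u : R) :
  is_derive (wronsk n) u (- (INR n ^ 2 - 1) * sin (INR n * u) * sin u).
Proof. unfold wronsk. auto_derive; [trivial|]. ring. Qed.

Lemma is_derive_sin_ratio (n : nat) (u : R) :
  sin u <> 0 ->
  is_derive (fun t => sin (INR n * t) / sin t) u (wronsk n u / sin u ^ 2).
Proof. intros H. unfold wronsk. auto_derive; [exact H|]. field. exact H. Qed.

Lemma Derive_chebU_cos (n : nat) (u : R) :
  (1 <= n)%nat -> Derive (chebU (n - 1)) (cos u) * sin u ^ 3 = - wronsk n u.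
Proof.
  intros Hn.
  assert (H1 : is_derive (fun t => chebU (n - 1) (cos t) * sin t) u
     (- sin u * Derive (chebU (n - 1)) (cos u) * sin u + chebU (n - 1) (cos u) * cos u)).
  { auto_derive; [apply ex_derive_chebU|]. change (fun x : R => chebU (n - 1) x) with (chebU (n - 1)). ring. }
  assert (H2 : is_derive (fun t => chebU (n - 1) (cos t) * sin t) u (INR n * cos (INR n * u))).
  { apply (is_derive_ext (fun t => sin (INR n * t))).
    - intros t. symmetry. now apply chebU_pred_cos.
    - auto_derive; [trivial|]. ring. }
  apply is_derive_unique in H1. apply is_derive_unique in H2. rewrite H1 in H2.
  unfold wronsk. rewrite <- H2, <- (chebU_pred_cos n u Hn). ring.
Qed.

Lemma angle_bounds (n : nat) : (3 <= n)%nat ->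
  0 < PI / INR n /\ 2 * PI / INR n < PI /\ PI / INR n < 2 * PI / INR n /\
  INR n * (PI / INR n) = PI /\ INR n * (2 * PI / INR n) = 2 * PI /\ PI / INR n < PI / 2.
Proof.
  intros Hn. assert (H3 : 3 <= INR n) by (apply (le_INR 3 n) in Hn; simpl in Hn; lra).
  assert (HP := PI_RGT_0).
  assert (E : INR n * (PI / INR n) = PI) by (field; lra).
  assert (E2 : 2 * PI / INR n = 2 * (PI / INR n)) by (field; lra).
  rewrite E2. set (p := PI / INR n) in *.
  assert (0 < p) by (unfold p; apply Rdiv_lt_0_compat; lra).
  repeat split; nra.
Qed.

(** wronsk changes sign between PI / n and 2 PI / n, and its zero is a critical
    point of U_{n-1} o cos. *)
Lemma x0'_spec (n : nat) : (3 <= n)%nat ->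
  cos (2 * PI / INR n) < x0' n < cos (PI / INR n) /\ Derive (chebU (n - 1)) (x0' n) = 0.
Proof.
  intros Hn. unfold x0'. apply epsilon_spec.
  destruct (angle_bounds n Hn) as (B1 & B2 & B3 & B4 & B5 & B6).
  set (a := PI / INR n) in *. set (b := 2 * PI / INR n) in *.
  assert (H3 : 3 <= INR n) by (apply (le_INR 3 n) in Hn; simpl in Hn; lra).
  assert (Qa : wronsk n a < 0).
  { unfold wronsk. rewrite B4, cos_PI, sin_PI.
    assert (0 < sin a) by (apply sin_gt_0; lra). nra. }
  assert (Qb : 0 < wronsk n b).
  { unfold wronsk. rewrite B5, cos_2PI, sin_2PI.
    assert (0 < sin b) by (apply sin_gt_0; lra). nra. }
  assert (Cq : continuity (wronsk n)).
  { intros x. apply derivable_continuous_pt. exists (- (INR n ^ 2 - 1) * sin (INR n * x) * sin x).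
    apply is_derive_Reals, is_derive_wronsk. }
  destruct (IVT (wronsk n) a b Cq B3 Qa Qb) as [u [[[Hu1|Hu1] [Hu2|Hu2]] E]];
    try (subst; lra).
  exists (cos u). split.
  - split; apply cos_decreasing_1; lra.
  - assert (H := Derive_chebU_cos n u ltac:(lia)). rewrite E, Ropp_0 in H.
    assert (0 < sin u) by (apply sin_gt_0; lra).
    apply Rmult_integral in H. destruct H as [H|H]; [exact H|].
    exfalso. assert (0 < sin u ^ 3) by (apply pow_lt; assumption). lra.
Qed.

Lemma sin_neg_lobe (n : nat) (u : R) : (3 <= n)%nat ->
  PI / INR n <= u <= 2 * PI / INR n -> sin (INR n * u) <= 0.
Proof.
  intros Hn Hu. destruct (angle_bounds n Hn) as (B1 & B2 & B3 & B4 & B5 & B6).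
  assert (0 < INR n) by (apply lt_0_INR; lia).
  apply sin_le_0; [rewrite <- B4 | rewrite <- B5]; apply Rmult_le_compat_l; lra.
Qed.

(** On this lobe wronsk is nondecreasing and vanishes at arccos x0', so the
    ratio sin nu / sin u falls before that angle and rises after it; being
    nonpositive, it has its largest modulus there. *)
Lemma N_min_bound_first_lobe (n : nat) (u : R) : (3 <= n)%nat ->
  PI / INR n <= u <= 2 * PI / INR n -> Rabs (sin (INR n * u)) <= N_min n * sin u.
Proof.
  intros Hn Hu. destruct (angle_bounds n Hn) as (B1 & B2 & B3 & B4 & B5 & B6).
  destruct (x0'_spec n Hn) as [[X1 X2] X3].
  set (a := PI / INR n) in *. set (b := 2 * PI / INR n) in *.
  set (t := acos (x0' n)).
  assert (Xb : -1 <= x0' n <= 1) by (generalize (COS_bound a) (COS_bound b); lra).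
  assert (Ct : cos t = x0' n) by (apply cos_acos; exact Xb).
  assert (Tb := acos_bound (x0' n)). fold t in Tb.
  assert (Ta : a < t) by (apply cos_decreasing_0; lra).
  assert (Tb2 : t < b) by (apply cos_decreasing_0; lra).
  assert (SP : forall x, a <= x <= b -> 0 < sin x) by (intros; apply sin_gt_0; lra).
  assert (Wt : wronsk n t = 0).
  { assert (H := Derive_chebU_cos n t ltac:(lia)). rewrite Ct, X3 in H. lra. }
  assert (NE : N_min n = Rabs (sin (INR n * t) / sin t)).
  { unfold N_min. rewrite <- Ct. f_equal. rewrite <- (chebU_pred_cos n t ltac:(lia)). field.
    apply Rgt_not_eq, SP. lra. }
  destruct (MVT_gen (fun x => sin (INR n * x) / sin x) t u
    (fun x => wronsk n x / sin x ^ 2)) as [c [Hc Ec]].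
  { intros x Hx. apply is_derive_sin_ratio. apply Rgt_not_eq, SP.
    revert Hx. unfold Rmin, Rmax. destruct Rle_dec; lra. }
  { intros x Hx. apply derivable_continuous_pt. exists (wronsk n x / sin x ^ 2).
    apply is_derive_Reals, is_derive_sin_ratio. apply Rgt_not_eq, SP.
    revert Hx. unfold Rmin, Rmax. destruct Rle_dec; lra. }
  destruct (MVT_gen (wronsk n) t c (fun x => - (INR n ^ 2 - 1) * sin (INR n * x) * sin x))
    as [d [Hd Ed]].
  { intros x Hx. apply is_derive_wronsk. }
  { intros x Hx. apply derivable_continuous_pt.
    exists (- (INR n ^ 2 - 1) * sin (INR n * x) * sin x).
    apply is_derive_Reals, is_derive_wronsk. }
  assert (Rc : a <= c <= b /\ 0 <= (c - t) * (u - t)).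
  { revert Hc. unfold Rmin, Rmax. destruct Rle_dec; intros; split; try lra; nra. }
  assert (Rd : a <= d <= b).
  { revert Hd. unfold Rmin, Rmax. destruct Rle_dec; lra. }
  assert (Pd : 0 <= - (INR n ^ 2 - 1) * sin (INR n * d) * sin d).
  { assert (H := SP d Rd). assert (H1 := sin_neg_lobe n d Hn Rd).
    assert (H3 : 3 <= INR n) by (apply (le_INR 3 n) in Hn; simpl in Hn; lra).
    assert (0 <= INR n ^ 2 - 1) by nra.
    replace (- (INR n ^ 2 - 1) * sin (INR n * d) * sin d)
      with ((INR n ^ 2 - 1) * (- sin (INR n * d)) * sin d) by ring.
    apply Rmult_le_pos; [apply Rmult_le_pos; lra|lra]. }
  assert (Inc : sin (INR n * t) / sin t <= sin (INR n * u) / sin u).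
  { assert (0 <= wronsk n c / sin c ^ 2 * (u - t)); [|lra].
    replace (wronsk n c) with (wronsk n c - wronsk n t) by lra. rewrite Ed.
    set (w := - (INR n ^ 2 - 1) * sin (INR n * d) * sin d) in *.
    replace (w * (c - t) / sin c ^ 2 * (u - t)) with (w * ((c - t) * (u - t)) / sin c ^ 2)
      by (field; apply Rgt_not_eq, SP; apply Rc).
    apply Rmult_le_pos; [apply Rmult_le_pos; [exact Pd|apply Rc]|].
    left. apply Rinv_0_lt_compat, pow_lt, SP, Rc. }
  assert (S1 := SP u Hu).
  assert (N1 := sin_neg_lobe n u Hn Hu).
  assert (N2 : sin (INR n * t) / sin t <= 0).
  { assert (H := sin_neg_lobe n t Hn ltac:(unfold a, b in *; lra)).
    assert (H2 := SP t ltac:(lra)). assert (0 < / sin t) by (apply Rinv_0_lt_compat; lra).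
    unfold Rdiv. nra. }
  rewrite NE, (Rabs_left1 _ N1), (Rabs_left1 _ N2).
  replace (- sin (INR n * u)) with (- (sin (INR n * u) / sin u) * sin u) by (field; lra).
  apply Rmult_le_compat_r; lra.
Qed.

(** Beyond the lobe, |sin nu| / sin u <= 1 / sin u, and this is below its value at
    the middle 3 PI / (2 n) of the lobe, where |sin nu| = 1. *)
Lemma N_min_bound (n : nat) (u : R) : (3 <= n)%nat ->
  PI / INR n <= u <= PI / 2 -> Rabs (sin (INR n * u)) <= N_min n * sin u.
Proof.
  intros Hn Hu. destruct (Rle_lt_dec u (2 * PI / INR n)) as [H|H].
  { apply N_min_bound_first_lobe; [exact Hn|lra]. }
  destruct (angle_bounds n Hn) as (B1 & B2 & B3 & B4 & B5 & B6).
  assert (E2 : 2 * PI / INR n = 2 * (PI / INR n)) by (unfold Rdiv; ring).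
  set (m := 3 / 2 * (PI / INR n)).
  assert (K := N_min_bound_first_lobe n m Hn ltac:(unfold m; lra)).
  replace (INR n * m) with (3 * (PI / 2)) in K by (unfold m; rewrite <- B4 at 1; field; apply not_0_INR; lia).
  rewrite sin_3PI2, Rabs_left in K by lra.
  assert (Sm : sin m <= sin u) by (apply sin_incr_1; unfold m; lra).
  assert (0 <= N_min n) by (unfold N_min; apply Rabs_pos).
  assert (Rabs (sin (INR n * u)) <= 1) by (apply Rabs_le; generalize (SIN_bound (INR n * u)); lra).
  nra.
Qed.

Lemma N_min_ge_1 (n : nat) : (3 <= n)%nat -> 1 <= N_min n.
Proof.
  intros Hn. destruct (angle_bounds n Hn) as (B1 & B2 & B3 & B4 & B5 & B6).
  assert (E2 : 2 * PI / INR n = 2 * (PI / INR n)) by (unfold Rdiv; ring).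
  set (m := 3 / 2 * (PI / INR n)).
  assert (K := N_min_bound_first_lobe n m Hn ltac:(unfold m; lra)).
  replace (INR n * m) with (3 * (PI / 2)) in K by (unfold m; rewrite <- B4 at 1; field; apply not_0_INR; lia).
  rewrite sin_3PI2, Rabs_left in K by lra.
  assert (0 <= N_min n) by (unfold N_min; apply Rabs_pos).
  generalize (SIN_bound m). nra.
Qed.

(** For n >= 4 this is contained in [N_min_bound], as PI / n <= PI / 4.  For
    n = 3, where PI / n is larger, the ratio is explicitly
    3 - 4 sin^2 u, of modulus at most 1 <= N_min on this range. *)
Lemma N_min_bound_quarter (n : nat) (u : R) : (3 <= n)%nat ->
  PI / 4 <= u <= PI / 2 -> Rabs (sin (INR n * u)) <= N_min n * sin u.
Proof.
  intros Hn Hu. assert (HP := PI_RGT_0).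
  assert (Su : 0 < sin u) by (apply sin_gt_0; lra).
  destruct (Nat.eq_dec n 3) as [->|H].
  - assert (N1 := N_min_ge_1 3 Hn).
    assert (Q : sin (PI / 4) <= sin u) by (apply sin_incr_1; lra).
    assert (Q4 : sin (PI / 4) ^ 2 = 1 / 2).
    { assert (H := sin_sqr (PI / 4)). rewrite <- sin_cos_PI4 in H. lra. }
    assert (0 < sin (PI / 4)) by (apply sin_gt_0; lra).
    assert (1 / 2 <= sin u ^ 2) by (rewrite <- Q4; apply pow_incr; lra).
    assert (sin u <= 1) by apply SIN_bound.
    assert (E : sin (INR 3 * u) = sin u * (3 - 4 * sin u ^ 2)).
    { replace (INR 3 * u) with (2 * u + u) by (simpl; ring).
      rewrite sin_plus, sin_2a, cos_2a_sin.
      assert (C : cos u * cos u = 1 - sin u ^ 2) by (generalize (sin_sqr u); lra).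
      replace (2 * sin u * cos u * cos u) with (2 * sin u * (cos u * cos u)) by ring.
      rewrite C. ring. }
    rewrite E, Rabs_mult, (Rabs_pos_eq (sin u)) by lra.
    assert (Rabs (3 - 4 * sin u ^ 2) <= 1) by (apply Rabs_le; nra). nra.
  - apply N_min_bound; [exact Hn|].
    assert (4 <= INR n) by (replace 4 with (INR 4) by (simpl; ring); apply le_INR; lia).
    split; [|lra].
    assert (PI / INR n <= PI / 4); [|lra].
    apply Rmult_le_compat_l; [lra|]. apply Rinv_le_contravar; lra.
Qed.

(** * The angle u0 *)

(** U_{n-1} rises from 0 at cos (PI / n) to n at 1. *)
Lemma x0_spec (n : nat) (N : R) : (3 <= n)%nat -> 0 < N < INR n ->
  0 < x0 n N < 1 /\ Rabs (chebU (n - 1) (x0 n N)) = N.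
Proof.
  intros Hn HN.
  enough (H : 0 < x0 n N /\ -1 < x0 n N < 1 /\ Rabs (chebU (n - 1) (x0 n N)) = N) by (split; lra).
  unfold x0. apply epsilon_spec.
  destruct (angle_bounds n Hn) as (B1 & B2 & B3 & B4 & B5 & B6).
  set (a := PI / INR n) in *.
  assert (Ca : 0 < cos a) by (apply cos_gt_0; lra).
  assert (Ca1 : cos a < 1) by (rewrite <- cos_0; apply cos_decreasing_1; lra).
  assert (Ua : chebU (n - 1) (cos a) = 0).
  { assert (H := chebU_pred_cos n a ltac:(lia)). rewrite B4, sin_PI in H.
    assert (0 < sin a) by (apply sin_gt_0; lra).
    apply Rmult_integral in H. lra. }
  assert (U1 : chebU (n - 1) 1 = INR n).
  { rewrite chebU_1, minus_INR by lia. simpl. ring. }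
  destruct (IVT_gen (chebU (n - 1)) (cos a) 1 N) as [x [Hx Ex]].
  { intros y. apply derivable_continuous_pt, ex_derive_Reals_0, ex_derive_chebU. }
  { rewrite Ua, U1. unfold Rmin, Rmax. repeat destruct Rle_dec; lra. }
  exists x. rewrite Ex.
  assert (x <> 1) by (intros ->; lra).
  unfold Rmin, Rmax in Hx. destruct Rle_dec in Hx; [|lra].
  split; [lra|]. split; [lra|]. apply Rabs_pos_eq. lra.
Qed.

Lemma u0_spec (n : nat) (N : R) : (3 <= n)%nat -> 0 < N < INR n ->
  0 < u0 n N < PI / 2 /\ Rabs (sin (INR n * u0 n N)) = N * sin (u0 n N).
Proof.
  intros Hn HN. destruct (x0_spec n N Hn HN) as [Hx Ex].
  unfold u0. destruct (Req_EM_T N (INR n)) as [E|_]; [lra|].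
  set (t := acos (x0 n N)).
  assert (Ct : cos t = x0 n N) by (apply cos_acos; lra).
  assert (Bt := acos_bound (x0 n N)). fold t in Bt.
  assert (T0 : 0 < t).
  { apply Rnot_le_lt. intros H. assert (E : t = 0) by lra. rewrite E, cos_0 in Ct. lra. }
  assert (T1 : t < PI / 2).
  { apply cos_decreasing_0; try lra. rewrite cos_PI2. lra. }
  split; [lra|].
  rewrite <- (chebU_pred_cos n t ltac:(lia)), Ct, Rabs_mult, Ex. f_equal.
  apply Rabs_pos_eq, sin_ge_0; lra.
Qed.

(** At u0 the ratio |sin nu| / sin u equals N, which [N_min_bound_quarter]
    excludes on [PI / 4, PI / 2]. *)
Lemma u0_lt_quarter (n : nat) (N : R) : (3 <= n)%nat -> N_min n < N < INR n ->
  u0 n N < PI / 4.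
Proof.
  intros Hn HN. assert (H1 := N_min_ge_1 n Hn).
  destruct (u0_spec n N Hn ltac:(lra)) as [B E].
  apply Rnot_le_lt. intros H.
  assert (K := N_min_bound_quarter n (u0 n N) Hn ltac:(lra)). rewrite E in K.
  assert (0 < sin (u0 n N)) by (apply sin_gt_0; lra). nra.
Qed.

(** N sin u0 = |sin n u0| <= ((n - 1) cos u0 + 1) sin u0 forces cos u0 to 1 as
    N tends to n. *)
Lemma u0_small (n : nat) (d : R) : (3 <= n)%nat -> 0 < d ->
  at_left (INR n) (fun N => 0 < N < INR n /\ 0 < u0 n N < d).
Proof.
  intros Hn Hd.
  assert (H3 : 3 <= INR n) by (apply (le_INR 3 n) in Hn; simpl in Hn; lra).
  assert (HP := PI_RGT_0).
  set (e := Rmin d (PI / 2)).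
  assert (He : 0 < e <= PI / 2 /\ e <= d).
  { unfold e. generalize (Rmin_l d (PI/2)) (Rmin_r d (PI/2)).
    assert (0 < Rmin d (PI / 2)) by (apply Rmin_glb_lt; lra). lra. }
  assert (Ce : cos e < 1) by (rewrite <- cos_0; apply cos_decreasing_1; lra).
  assert (C0 : 0 <= cos e) by (apply cos_ge_0; lra).
  assert (Hr : 0 < (INR n - 1) * (1 - cos e)) by (apply Rmult_lt_0_compat; lra).
  exists (mkposreal _ Hr). intros N HN Hlt.
  ball_abs in HN.
  apply Rabs_def2 in HN.
  assert (HN0 : 0 < N < INR n) by nra.
  split; [exact HN0|].
  destruct (u0_spec n N Hn HN0) as [B E]. split; [lra|].
  apply Rnot_le_lt. intros Hde.
  assert (K := abs_sin_mult_le_cos n (u0 n N) ltac:(lia)). rewrite E in K.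
  assert (S0 : 0 < sin (u0 n N)) by (apply sin_gt_0; lra).
  rewrite (Rabs_pos_eq (sin _)), (Rabs_pos_eq (cos _)) in K by (try lra; apply cos_ge_0; lra).
  apply Rmult_le_reg_r in K; [|exact S0].
  assert (cos (u0 n N) <= cos e).
  { destruct (Req_dec e (u0 n N)) as [-> | Hne]; [lra|].
    left. apply cos_decreasing_1; lra. }
  nra.
Qed.

(** * The loops *)

Lemma level_axis (k : eigtype) (n : nat) (N sg w : R) :
  admissible k n -> sg = 1 \/ sg = -1 -> (2 <= n)%nat -> 0 <= N <= INR n ->
  0 <= N ^ 2 * cos w ^ 2 - cos (INR n * w) ^ 2 ->
  let h := v n N (- sg * (PI / 2) + w) in
  cosh (INR n * h) ^ 2 - N ^ 2 * cosh h ^ 2 = sin (INR n * w) ^ 2 - N ^ 2 * sin w ^ 2.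
Proof.
  intros Hk Hsg Hn HN Hg h.
  rewrite <- (gap_axis k n N sg w Hk Hsg) in Hg.
  destruct (v_spec n N _ Hn HN Hg) as [_ E].
  rewrite (gap_axis k n N sg w Hk Hsg) in E. fold h in E. unfold lift in E.
  rewrite !cosh_sqr, !sin_sqr. lra.
Qed.

(** The left-hand side is even in w and equals gap at PI / 2 - |w|, an angle in
    the range of [N_min_bound_quarter]. *)
Lemma axis_gap_pos (k : eigtype) (n : nat) (N w : R) :
  admissible k n -> (3 <= n)%nat -> N_min n < N -> Rabs w <= PI / 4 ->
  0 < N ^ 2 * cos w ^ 2 - cos (INR n * w) ^ 2.
Proof.
  intros Hk Hn HN Hw.
  assert (H1 := N_min_ge_1 n Hn).
  assert (Rw := Rabs_pos w).
  assert (E : N ^ 2 * cos w ^ 2 - cos (INR n * w) ^ 2 = gap n N (- (-1) * (PI / 2) + - Rabs w)).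
  { rewrite (gap_axis k n N (-1)) by auto.
    unfold Rabs; destruct Rcase_abs;
      [rewrite Ropp_involutive | rewrite Ropp_mult_distr_r_reverse, !cos_neg]; reflexivity. }
  rewrite E. unfold gap. set (u := - (-1) * (PI / 2) + - Rabs w).
  assert (Hu : PI / 4 <= u <= PI / 2) by (unfold u; lra).
  assert (K := N_min_bound_quarter n u Hn Hu).
  assert (HP := PI_RGT_0).
  assert (0 < sin u) by (apply sin_gt_0; lra).
  rewrite <- (pow2_abs (sin (INR n * u))).
  assert (Rabs (sin (INR n * u)) < N * sin u) by nra.
  generalize (Rabs_pos (sin (INR n * u))). nra.
Qed.

(** Both comparisons go the same way: cos nw <= N cos w from the sign of the gap,
    and N sinh h < sinh nh. *)
Lemma axis_im_pos (n : nat) (N w h : R) :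
  (2 <= n)%nat -> 0 <= N <= INR n -> 0 < h ->
  0 <= N ^ 2 * cos w ^ 2 - cos (INR n * w) ^ 2 ->
  0 < cos w -> 0 < axis_im n w h.
Proof.
  intros Hn HN Hh Hg Hc. unfold axis_im.
  assert (S1 := sinh_mult_gt n h Hn Hh). assert (S2 := sinh_pos h Hh).
  assert (cos (INR n * w) <= N * cos w).
  { apply Rnot_lt_le. intros H. assert (0 <= N * cos w) by (apply Rmult_le_pos; lra). nra. }
  assert (N * sinh h < sinh (INR n * h)) by nra.
  nra.
Qed.

(** The modulus is N sin u0 by construction; the sign is positive because
    [N_min_bound] puts u0 below PI / n. *)
Lemma sin_mult_u0 (n : nat) (N : R) : (3 <= n)%nat -> N_min n < N < INR n ->
  sin (INR n * u0 n N) = N * sin (u0 n N).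
Proof.
  intros Hn HN. assert (H1 := N_min_ge_1 n Hn).
  destruct (u0_spec n N Hn ltac:(lra)) as [B E].
  rewrite <- E. symmetry. apply Rabs_pos_eq.
  assert (S0 : 0 < sin (u0 n N)) by (apply sin_gt_0; lra).
  destruct (angle_bounds n Hn) as (B1 & B2 & B3 & B4 & B5 & B6).
  assert (U : u0 n N < PI / INR n).
  { apply Rnot_le_lt. intros H. assert (K := N_min_bound n (u0 n N) Hn ltac:(lra)).
    rewrite E in K. nra. }
  assert (0 < INR n) by (apply lt_0_INR; lia).
  apply sin_ge_0; [apply Rmult_le_pos; lra|].
  rewrite <- B4. apply Rmult_le_compat_l; lra.
Qed.

(** With sin nw = N sin w the level equation reduces to cosh nh = N cosh h, and
    the two terms of axis_re cancel. *)
Lemma axis_re_u0 (k : eigtype) (n : nat) (N sg w : R) :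
  admissible k n -> sg = 1 \/ sg = -1 -> (3 <= n)%nat -> N_min n < N < INR n ->
  w = u0 n N \/ w = - u0 n N ->
  axis_re n w (v n N (- sg * (PI / 2) + w)) = 0.
Proof.
  intros Hk Hsg Hn HN Hw. assert (H1 := N_min_ge_1 n Hn).
  assert (U := u0_lt_quarter n N Hn HN).
  destruct (u0_spec n N Hn ltac:(lra)) as [B _].
  assert (S : sin (INR n * w) = N * sin w).
  { destruct Hw as [-> | ->]; rewrite ?Ropp_mult_distr_r_reverse, ?sin_neg, sin_mult_u0 by assumption;
    ring. }
  assert (Rw : Rabs w <= PI / 4) by (apply Rabs_le; destruct Hw; lra).
  assert (L := level_axis k n N sg w Hk Hsg ltac:(lia) ltac:(lra)
    (Rlt_le _ _ (axis_gap_pos k n N w Hk Hn (proj1 HN) Rw))).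
  simpl in L. rewrite S in L. unfold axis_re. rewrite S.
  set (h := v n N (- sg * (PI / 2) + w)) in *.
  assert (C : cosh (INR n * h) = N * cosh h).
  { assert (P1 := cosh_pos (INR n * h)). assert (P2 := cosh_pos h).
    assert (0 < N * cosh h) by (apply Rmult_lt_0_compat; lra). nra. }
  rewrite C. ring.
Qed.

Lemma loop_point (k : eigtype) (n : nat) (N sg u : R) :
  admissible k n -> sg = 1 \/ sg = -1 -> (3 <= n)%nat -> N_min n < N < INR n ->
  - sg * (PI / 2) - u0 n N <= u <= - sg * (PI / 2) + u0 n N ->
  let w := u + sg * (PI / 2) in
  let h := v n N u in
  f k n N u = (sg * (axis_re n w h / axis_den n w h), sg * (axis_im n w h / axis_den n w h)) /\
  0 < axis_im n w h / axis_den n w h /\ Rset n N u.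
Proof.
  intros Hk Hsg Hn HN Hu w h. assert (H1 := N_min_ge_1 n Hn).
  assert (U := u0_lt_quarter n N Hn HN).
  destruct (u0_spec n N Hn ltac:(lra)) as [B _].
  assert (Ew : u = - sg * (PI / 2) + w) by (unfold w; ring).
  assert (Rw : Rabs w <= PI / 4) by (apply Rabs_le; unfold w; lra).
  assert (G := axis_gap_pos k n N w Hk Hn (proj1 HN) Rw).
  assert (Hh : 0 < h).
  { apply v_pos; [lia|lra|]. rewrite Ew, (gap_axis k) by assumption. exact G. }
  split; [|split].
  - unfold h in *. rewrite Ew in *. apply f_axis; auto; lia.
  - apply Rdiv_lt_0_compat; [|apply axis_den_pos; [lia|exact Hh]].
    apply axis_im_pos with N; [lia|lra|exact Hh|lra|].
    assert (HP := PI_RGT_0).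
    apply Rabs_le_between in Rw. apply cos_gt_0; lra.
  - unfold Rset. destruct Hsg; subst sg; [left|right]; lra.
Qed.

(** The open upper half-plane for sg = 1 and the lower one for sg = -1. *)
Definition half (sg : R) (rho : C) : Prop := 0 < sg * Im rho.

Lemma self_intersection (k : eigtype) (n : nat) (N sg u : R) :
  admissible k n -> sg = 1 \/ sg = -1 -> (3 <= n)%nat -> N_min n < N < INR n ->
  u = - sg * (PI / 2) - u0 n N \/ u = - sg * (PI / 2) + u0 n N ->
  Re (f k n N u) = 0.
Proof.
  intros Hk Hsg Hn HN Hu. assert (H1 := N_min_ge_1 n Hn).
  destruct (u0_spec n N Hn ltac:(lra)) as [B _].
  destruct (loop_point k n N sg u Hk Hsg Hn HN ltac:(destruct Hu; lra)) as [E _].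
  simpl in E. rewrite E. simpl Re.
  assert (Ew : u = - sg * (PI / 2) + (u + sg * (PI / 2))) by ring.
  assert (Z := axis_re_u0 k n N sg (u + sg * (PI / 2)) Hk Hsg Hn HN ltac:(destruct Hu; subst; [right|left]; ring)).
  rewrite <- Ew in Z. rewrite Z. unfold Rdiv. ring.
Qed.

Lemma axis_even (n : nat) (w h : R) :
  axis_im n (- w) h = axis_im n w h /\ axis_den n (- w) h = axis_den n w h.
Proof.
  unfold axis_im, axis_den. rewrite !Ropp_mult_distr_r_reverse, !cos_neg. split; reflexivity.
Qed.

Lemma v_even (k : eigtype) (n : nat) (N sg w : R) :
  admissible k n -> sg = 1 \/ sg = -1 -> (2 <= n)%nat -> 0 <= N <= INR n ->
  0 <= N ^ 2 * cos w ^ 2 - cos (INR n * w) ^ 2 ->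
  v n N (- sg * (PI / 2) + - w) = v n N (- sg * (PI / 2) + w).
Proof.
  intros Hk Hsg Hn HN Hg.
  assert (G1 := gap_axis k n N sg w Hk Hsg). assert (G2 := gap_axis k n N sg (- w) Hk Hsg).
  rewrite Ropp_mult_distr_r_reverse, !cos_neg, <- G1 in G2. rewrite <- G1 in Hg.
  destruct (v_spec n N _ Hn HN Hg) as [P1 E1].
  rewrite <- G2 in Hg. destruct (v_spec n N _ Hn HN Hg) as [P2 E2].
  apply Rle_antisym; apply Rnot_lt_le; intros H.
  - generalize (lift_lt n N _ _ Hn HN (conj P1 H)). lra.
  - generalize (lift_lt n N _ _ Hn HN (conj P2 H)). lra.
Qed.

Lemma is_loop_half (k : eigtype) (n : nat) (N sg : R) :
  admissible k n -> sg = 1 \/ sg = -1 -> (3 <= n)%nat -> N_min n < N < INR n ->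
  is_loop k n N (half sg) (- sg * (PI / 2) - u0 n N) (- sg * (PI / 2) + u0 n N).
Proof.
  intros Hk Hsg Hn HN. assert (H1 := N_min_ge_1 n Hn).
  destruct (u0_spec n N Hn ltac:(lra)) as [B _].
  assert (U := u0_lt_quarter n N Hn HN).
  repeat split.
  - lra.
  - intros u Hu. apply (loop_point k n N sg u Hk Hsg Hn HN Hu).
  - assert (R1 := self_intersection k n N sg (- sg * (PI / 2) - u0 n N) Hk Hsg Hn HN (or_introl eq_refl)).
    assert (R2 := self_intersection k n N sg (- sg * (PI / 2) + u0 n N) Hk Hsg Hn HN (or_intror eq_refl)).
    destruct (loop_point k n N sg (- sg * (PI / 2) - u0 n N) Hk Hsg Hn HN ltac:(lra)) as [E1 _].
    destruct (loop_point k n N sg (- sg * (PI / 2) + u0 n N) Hk Hsg Hn HN ltac:(lra)) as [E2 _].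
    simpl in E1, E2. rewrite E1 in R1 |- *. rewrite E2 in R2 |- *.
    simpl Re in R1, R2. rewrite R1, R2. f_equal.
    replace (- sg * (PI / 2) - u0 n N + sg * (PI / 2)) with (- u0 n N) by ring.
    replace (- sg * (PI / 2) + u0 n N + sg * (PI / 2)) with (u0 n N) by ring.
    assert (V := v_even k n N sg (u0 n N) Hk Hsg ltac:(lia) ltac:(lra)
      (Rlt_le _ _ (axis_gap_pos k n N (u0 n N) Hk Hn (proj1 HN) ltac:(apply Rabs_le; lra)))).
    unfold Rminus. rewrite V.
    destruct (axis_even n (u0 n N) (v n N (- sg * (PI / 2) + u0 n N))) as [-> ->]. reflexivity.
  - intros rho [u [Hu ->]]. unfold half.
    destruct (loop_point k n N sg u Hk Hsg Hn HN Hu) as [E [P _]]. simpl in E, P.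
    rewrite E. simpl Im. destruct Hsg; subst sg; lra.
Qed.

(** * Continuity of the level curve *)

(** A positive gap keeps v positive nearby, so f agrees there with its
    Cartesian form, whose denominator stays away from 0. *)
Lemma lim_f {T} {F : (T -> Prop) -> Prop} {FF : Filter F}
  (k : eigtype) (n : nat) (Nf uf : T -> R) (N u : R) :
  (2 <= n)%nat -> 0 <= N <= INR n -> 0 < gap n N u ->
  filterlim Nf F (locally N) -> filterlim uf F (locally u) ->
  F (fun t => 0 <= Nf t <= INR n) ->
  filterlim (fun t => f k n (Nf t) (uf t)) F (locally (f k n N u)).
Proof.
  intros Hn HN Hg LN Lu Hev.
  assert (Lgap := lim_gap n Nf uf N u LN Lu).
  assert (Ev : F (fun t => 0 <= Nf t <= INR n /\ 0 < gap n (Nf t) (uf t))).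
  { apply filter_and; [exact Hev|].
    apply (lim_lt (fun _ => 0) _ 0 _ (lim_const 0) Lgap Hg). }
  assert (Lv : filterlim (fun t => v n (Nf t) (uf t)) F (locally (v n N u))).
  { apply lim_v; auto; [lra|]. revert Ev. apply filter_imp. intros t [A B]. split; [exact A|lra]. }
  assert (Hv : 0 < v n N u) by (apply v_pos; assumption).
  rewrite (f_cartesian k n N u Hn Hv).
  apply (filterlim_ext_loc (fun t => cartesian k n (uf t) (v n (Nf t) (uf t)))).
  { revert Ev. apply filter_imp. intros t [A B]. symmetry. apply f_cartesian; [exact Hn|].
    apply v_pos; assumption. }
  assert (Lc : forall a, filterlim (fun t => cosh (a * v n (Nf t) (uf t))) F
     (locally (cosh (a * v n N u)))).
  { intros a. apply (lim_comp (fun t => a * v n (Nf t) (uf t)) cosh); [apply continuous_cosh|].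
    apply lim_mult; [apply lim_const|exact Lv]. }
  assert (Ls : forall a, filterlim (fun t => sinh (a * v n (Nf t) (uf t))) F
     (locally (sinh (a * v n N u)))).
  { intros a. apply (lim_comp (fun t => a * v n (Nf t) (uf t)) sinh); [apply continuous_sinh|].
    apply lim_mult; [apply lim_const|exact Lv]. }
  assert (Lcos : forall a, filterlim (fun t => cos (a * uf t)) F (locally (cos (a * u)))).
  { intros a. apply (lim_comp (fun t => a * uf t) cos); [apply continuous_cos_R|].
    apply lim_mult; [apply lim_const|exact Lu]. }
  assert (Lsin : forall a, filterlim (fun t => sin (a * uf t)) F (locally (sin (a * u)))).
  { intros a. apply (lim_comp (fun t => a * uf t) sin); [apply continuous_sin_R|].
    apply lim_mult; [apply lim_const|exact Lu]. }
  assert (HD := cartesian_den_pos k n N u Hn Hv).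
  assert (LD : filterlim (fun t => cosh ((INR n - 1) * v n (Nf t) (uf t))
      - sgn k * cos ((INR n - 1) * uf t)) F
     (locally (cosh ((INR n - 1) * v n N u) - sgn k * cos ((INR n - 1) * u)))).
  { apply lim_minus; [apply Lc|]. apply lim_mult; [apply lim_const|apply Lcos]. }
  unfold cartesian. apply lim_pair; (apply lim_div; [lra| |exact LD]).
  - apply lim_minus.
    + apply lim_mult; [|apply Lc]. apply (lim_comp uf cos); [apply continuous_cos_R|exact Lu].
    + apply lim_mult; [apply lim_const|]. apply lim_mult; [apply Lcos|].
      apply (lim_comp (fun t => v n (Nf t) (uf t)) cosh); [apply continuous_cosh|exact Lv].
  - apply lim_plus.
    + apply (lim_comp (fun t => sin (uf t) * sinh (INR n * v n (Nf t) (uf t))) Ropp).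
      { apply (continuous_opp (fun x : R => x)), continuous_id. }
      apply lim_mult; [|apply Ls]. apply (lim_comp uf sin); [apply continuous_sin_R|exact Lu].
    + apply lim_mult; [apply lim_const|]. apply lim_mult; [apply Lsin|].
      apply (lim_comp (fun t => v n (Nf t) (uf t)) sinh); [apply continuous_sinh|exact Lv].
Qed.

Lemma gap_center (k : eigtype) (n : nat) (sg : R) :
  admissible k n -> sg = 1 \/ sg = -1 -> (2 <= n)%nat ->
  0 < gap n (INR n) (- sg * (PI / 2)).
Proof.
  intros Hk Hsg Hn.
  rewrite <- (Rplus_0_r (- sg * (PI / 2))), (gap_axis k n _ sg 0 Hk Hsg).
  rewrite Rmult_0_r, cos_0. assert (1 < INR n) by (apply lt_1_INR; lia). nra.
Qed.

(** Joint continuity at (n, - sg * PI / 2) gives one neighbourhood of that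
    point on which f is within eps; since u0 tends to 0, the whole loop
    lies in it. *)
Lemma shrinks_half (k : eigtype) (n : nat) (sg : R) :
  admissible k n -> sg = 1 \/ sg = -1 -> (3 <= n)%nat ->
  shrinks_to k n (fun N => - sg * (PI / 2) - u0 n N) (fun N => - sg * (PI / 2) + u0 n N)
    (f k n (INR n) (- sg * (PI / 2))).
Proof.
  intros Hk Hsg Hn eps.
  assert (H3 : 3 <= INR n) by (apply (le_INR 3 n) in Hn; simpl in Hn; lra).
  set (u := - sg * (PI / 2)).
  assert (FF : Filter (filter_prod (at_left (INR n)) (locally u))).
  { apply filter_prod_filter; apply filter_filter. }
  assert (L : filterlim (fun p : R * R => f k n (fst p) (snd p))
     (filter_prod (at_left (INR n)) (locally u)) (locally (f k n (INR n) u))).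
  { apply lim_f; [lia|lra|apply (gap_center k); auto; lia| | |].
    - apply (filterlim_filter_le_2 (F := filter_prod (at_left (INR n)) (locally u)) (G := at_left (INR n)) fst).
      + intros P [e He]. exists e. auto.
      + apply filterlim_fst.
    - apply filterlim_snd.
    - apply Filter_prod with (fun N => 0 < N < INR n /\ 0 < u0 n N < 1) (fun _ => True).
      + apply u0_small; [exact Hn|lra].
      + apply filter_true.
      + simpl. intros. lra. }
  assert (He : 0 < eps / 2) by (generalize (cond_pos eps); lra).
  destruct (proj1 (filterlim_locally _ _) L (mkposreal _ He)) as [Q1 Q2 H1 H2 H].
  destruct H2 as [d Hd].
  generalize (filter_and _ _ H1 (u0_small n d Hn (cond_pos d))).
  apply filter_imp. intros N [HQ [HN Hu0]] rho [t [Ht ->]].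
  assert (Ht2 : Q2 t).
  { apply Hd. ball_abs.
    apply Rabs_def1; unfold u in *; lra. }
  destruct (H N t HQ Ht2) as [A B].
  ball_abs in A. ball_abs in B.
  eapply Rle_lt_trans; [apply Cmod_2Rmax|].
  assert (S2 : sqrt 2 < 2) by (rewrite <- (sqrt_square 2) at 2 by lra; apply sqrt_lt_1; lra).
  assert (S0 := sqrt_pos 2).
  set (m := Rmax _ _).
  assert (M : 0 <= m < eps / 2).
  { split; [unfold m; eapply Rle_trans; [apply Rabs_pos|apply Rmax_l]|].
    apply Rmax_lub_lt; assumption. }
  nra.
Qed.

(** * The cusp *)

Lemma lim_difference_quotient (g : R -> R) (x l : R) :
  derivable_pt_lim g x l ->
  filterlim (fun h => (g (x + h) - g x) / h) (locally' 0) (locally l).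
Proof.
  intros H. apply filterlim_locally. intros eps.
  destruct (H eps (cond_pos eps)) as [d Hd].
  exists d. intros h Hh Hne.
  ball_abs in *.
  apply Hd; [exact Hne|]. rewrite Ropp_0, Rplus_0_r in Hh. exact Hh.
Qed.

Lemma lim_sin_ratio (b : R) : filterlim (fun w => sin (b * w) / w) (locally' 0) (locally b).
Proof.
  assert (H : derivable_pt_lim (fun w => sin (b * w)) 0 b).
  { apply is_derive_Reals. auto_derive; [trivial|]. rewrite Rmult_0_r, cos_0. ring. }
  apply lim_difference_quotient in H. revert H. apply filterlim_ext. intros w.
  rewrite Rplus_0_l, Rmult_0_r, sin_0, Rminus_0_r. reflexivity.
Qed.

Lemma locally'_neq (x : R) : locally' x (fun t => t <> x).
Proof. exists (mkposreal 1 Rlt_0_1). intros y _ H. exact H. Qed.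

Lemma lim_1_minus_cos (a : R) :
  filterlim (fun w => (1 - cos (a * w)) / w ^ 2) (locally' 0) (locally (a ^ 2 / 2)).
Proof.
  apply (filterlim_ext_loc (fun w => 2 * (sin (a / 2 * w) / w) ^ 2)).
  { generalize (locally'_neq 0). apply filter_imp. intros w Hw.
    replace (a * w) with (2 * (a / 2 * w)) by field. rewrite cos_2a_sin. field. exact Hw. }
  replace (a ^ 2 / 2) with (2 * (a / 2) ^ 2) by field.
  apply lim_mult; [apply lim_const|]. apply lim_pow, lim_sin_ratio.
Qed.

Lemma lim_id_0 : filterlim (fun w : R => w) (locally' 0) (locally 0).
Proof. intros P [e He]. exists e. auto. Qed.

Lemma lim_sin_mult_0 (b : R) : filterlim (fun w => sin (b * w)) (locally' 0) (locally 0).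
Proof.
  replace (locally 0) with (locally (sin (b * 0))) by (rewrite Rmult_0_r, sin_0; reflexivity).
  apply (lim_comp (fun w => b * w) sin); [apply continuous_sin_R|].
  apply lim_mult; [apply lim_const|apply lim_id_0].
Qed.

(** By induction on n: the step adds sin nw (1 - cos w) + sin w (1 - cos nw),
    which is a vanishing factor times a quantity of order w^2. *)
Lemma lim_sin_defect (n : nat) :
  filterlim (fun w => (INR n * sin w - sin (INR n * w)) / w ^ 2) (locally' 0) (locally 0).
Proof.
  induction n as [|n IH].
  - apply (filterlim_ext (fun _ => 0)); [|apply lim_const].
    intros w. simpl. rewrite !Rmult_0_l, sin_0. unfold Rdiv. ring.
  - apply (filterlim_ext (fun w => (INR n * sin w - sin (INR n * w)) / w ^ 2
      + (sin (INR n * w) * ((1 - cos (1 * w)) / w ^ 2)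
         + sin (1 * w) * ((1 - cos (INR n * w)) / w ^ 2)))).
    { intros w. rewrite S_INR, (Rmult_plus_distr_r (INR n) 1 w), sin_plus, !Rmult_1_l. unfold Rdiv. ring. }
    replace (locally 0) with (locally (0 + (0 * (1 ^ 2 / 2) + 0 * (INR n ^ 2 / 2)))) by (f_equal; ring).
    apply lim_plus; [exact IH|].
    apply lim_plus; (apply lim_mult; [apply lim_sin_mult_0|apply lim_1_minus_cos]).
Qed.

Lemma locally_Rabs (x : R) (P : R -> Prop) (d : posreal) :
  (forall y : R, Rabs (y - x) < d -> P y) -> locally x P.
Proof. intros H. exists d. intros y Hy. apply H, Hy. Qed.

Lemma derive_lower_bound (g : R -> R) (x l : R) :
  0 < l -> derivable_pt_lim g x l ->
  locally x (fun y => Rabs (y - x) <= 2 / l * Rabs (g y - g x)).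
Proof.
  intros Hl H. destruct (H (l / 2) ltac:(lra)) as [d Hd].
  apply (locally_Rabs x _ d). intros y Hy.
  destruct (Req_dec y x) as [->|Hne].
  { rewrite !Rminus_diag, Rabs_R0. lra. }
  assert (Hne' : y - x <> 0) by lra.
  specialize (Hd (y - x) Hne' Hy). replace (x + (y - x)) with y in Hd by ring.
  apply Rabs_def2 in Hd.
  set (q := (g y - g x) / (y - x)) in *.
  assert (E : g y - g x = q * (y - x)) by (unfold q; field; exact Hne').
  rewrite E, Rabs_mult, (Rabs_pos_eq q) by lra.
  rewrite <- Rmult_assoc. rewrite <- (Rmult_1_l (Rabs (y - x))) at 1.
  apply Rmult_le_compat_r; [apply Rabs_pos|].
  apply Rmult_le_reg_l with l; [exact Hl|]. field_simplify; lra.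
Qed.

Lemma derive_upper_bound (g : R -> R) (x l : R) :
  derivable_pt_lim g x l ->
  locally x (fun y => Rabs (g y - g x) <= (Rabs l + 1) * Rabs (y - x)).
Proof.
  intros H. destruct (H 1 ltac:(lra)) as [d Hd].
  apply (locally_Rabs x _ d). intros y Hy.
  destruct (Req_dec y x) as [->|Hne].
  { rewrite !Rminus_diag, Rabs_R0. lra. }
  assert (Hne' : y - x <> 0) by lra.
  specialize (Hd (y - x) Hne' Hy). replace (x + (y - x)) with y in Hd by ring.
  set (q := (g y - g x) / (y - x)) in *.
  assert (E : g y - g x = q * (y - x)) by (unfold q; field; exact Hne').
  rewrite E, Rabs_mult. apply Rmult_le_compat_r; [apply Rabs_pos|].
  assert (Rabs q <= Rabs (q - l) + Rabs l); [|lra].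
  replace q with (q - l + l) at 1 by ring. apply Rabs_triang.
Qed.

(** If y has order w^2 exactly and x is smaller, then the direction of (x, y) tends
    to a vertical unit vector; it is the same on both sides of 0 since w^2 is even. *)
Lemma lim_direction {F : (R -> Prop) -> Prop} {FF : Filter F} (x y : R -> R) (l : R) :
  l <> 0 -> F (fun w => w <> 0) ->
  filterlim (fun w => x w / w ^ 2) F (locally 0) ->
  filterlim (fun w => y w / w ^ 2) F (locally l) ->
  filterlim (fun w => ((x w, y w) / RtoC (Cmod (x w, y w)))%C) F
    (locally ((0, l / Rabs l) : C)).
Proof.
  intros Hl Hw Lx Ly.
  set (r := fun w => sqrt ((x w / w ^ 2) ^ 2 + (y w / w ^ 2) ^ 2)).
  assert (Lr : filterlim r F (locally (Rabs l))).
  { replace (Rabs l) with (sqrt (0 ^ 2 + l ^ 2)).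
    2:{ rewrite <- sqrt_Rsqr_abs. f_equal. unfold Rsqr. ring. }
    apply (lim_comp (fun w => (x w / w ^ 2) ^ 2 + (y w / w ^ 2) ^ 2) sqrt).
    - apply continuous_sqrt.
    - apply lim_plus; now apply lim_pow. }
  assert (Hr : F (fun w => 0 < r w)).
  { apply (lim_lt (fun _ => 0) r 0 (Rabs l)); [apply lim_const|exact Lr|now apply Rabs_pos_lt]. }
  apply (filterlim_ext_loc (fun w => ((x w / w ^ 2) / r w, (y w / w ^ 2) / r w) : C)).
  - generalize (filter_and _ _ Hw Hr). apply filter_imp. intros w [W Rw].
    assert (W2 : 0 < w ^ 2) by (apply pow2_gt_0; exact W).
    assert (E : Cmod (x w, y w) = w ^ 2 * r w).
    { unfold Cmod, r; simpl fst; simpl snd.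
      replace (x w ^ 2 + y w ^ 2)
        with ((w ^ 2) ^ 2 * ((x w / w ^ 2) ^ 2 + (y w / w ^ 2) ^ 2)) by (field; exact W).
      rewrite sqrt_mult, sqrt_pow2; [reflexivity|lra|apply pow2_ge_0|].
      generalize (pow2_ge_0 (x w / w ^ 2)) (pow2_ge_0 (y w / w ^ 2)). lra. }
    rewrite E. unfold Cdiv, Cinv, Cmult, RtoC; simpl fst; simpl snd.
    f_equal; field; split; try lra; split; lra.
  - replace (0, l / Rabs l) with (0 / Rabs l, l / Rabs l) by (f_equal; unfold Rdiv; ring).
    apply lim_pair; (apply lim_div; [|assumption|exact Lr]); now apply Rabs_no_R0.
Qed.

(** The second-order coefficient of axis_im / axis_den at the cusp has a sign
    that is not visible from its two competing terms.  The relation C = n c makes it a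
    negative multiple of S - s.  The factorization behind this is
    (S + n s)(C c - S s - 1) = (n - 1)(S - s). *)
Lemma cusp_curvature (n C c S s : R) :
  C = n * c -> C ^ 2 = 1 + S ^ 2 -> c ^ 2 = 1 + s ^ 2 ->
  (n ^ 2 * s - S) * (C * c - S * s - 1) - (n - 1) ^ 2 * (S - s)
  = - n * (S - s) * (C * c - S * s - 1).
Proof.
  intros E1 E2 E3. subst C.
  assert (E4 : S ^ 2 = n ^ 2 * (1 + s ^ 2) - 1) by (rewrite <- E3; lra).
  replace (n * c * c) with (n * (1 + s ^ 2)) by (rewrite <- E3; ring).
  enough (H : (S + n * s) * (n * (1 + s ^ 2) - S * s - 1) = (n - 1) * (S - s)).
  { apply Rminus_diag_uniq.
    transitivity ((n - 1) * ((S + n * s) * (n * (1 + s ^ 2) - S * s - 1) - (n - 1) * (S - s)));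
      [ring|rewrite H; ring]. }
  transitivity (S * n * (1 + s ^ 2) - S ^ 2 * s - S + n ^ 2 * s * (1 + s ^ 2) - n * s * s * S - n * s);
    [ring|]. rewrite E4. ring.
Qed.

Lemma lim_o_compose {F : (R -> Prop) -> Prop} {FF : Filter F} (g : R -> R) (l x : R) (h : R -> R) :
  derivable_pt_lim g x l -> g x = 0 ->
  filterlim h F (locally x) ->
  filterlim (fun w => (h w - x) / w ^ 2) F (locally 0) ->
  filterlim (fun w => g (h w) / w ^ 2) F (locally 0).
Proof.
  intros Hg Gx Lh Lhh.
  apply (lim_squeeze_abs _ (fun w => (Rabs l + 1) * Rabs ((h w - x) / w ^ 2))).
  - assert (B := Lh _ (derive_upper_bound g x _ Hg)). revert B. unfold filtermap.
    apply filter_imp. intros w B. rewrite Gx, Rminus_0_r in B.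
    unfold Rdiv. rewrite !Rabs_mult, <- Rmult_assoc.
    apply Rmult_le_compat_r; [apply Rabs_pos|exact B].
  - replace (locally 0) with (locally ((Rabs l + 1) * Rabs 0)) by (rewrite Rabs_R0, Rmult_0_r; reflexivity).
    apply lim_mult; [apply lim_const|].
    apply (lim_comp _ Rabs); [apply continuous_Rabs|exact Lhh].
Qed.

(** A nonzero derivative makes |h - x| comparable to |g(h)|. *)
Lemma lim_o_inverse {F : (R -> Prop) -> Prop} {FF : Filter F} (g : R -> R) (l x : R) (h : R -> R) :
  0 < l -> derivable_pt_lim g x l -> g x = 0 ->
  filterlim h F (locally x) ->
  filterlim (fun w => g (h w) / w ^ 2) F (locally 0) ->
  filterlim (fun w => (h w - x) / w ^ 2) F (locally 0).
Proof.
  intros Hl Hg Gx Lh Lgh.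
  apply (lim_squeeze_abs _ (fun w => 2 / l * Rabs (g (h w) / w ^ 2))).
  - assert (B := Lh _ (derive_lower_bound g x _ Hl Hg)). revert B. unfold filtermap.
    apply filter_imp. intros w B. rewrite Gx, Rminus_0_r in B.
    unfold Rdiv at 1 3. rewrite !Rabs_mult, <- Rmult_assoc.
    apply Rmult_le_compat_r; [apply Rabs_pos|exact B].
  - replace (locally 0) with (locally (2 / l * Rabs 0)) by (rewrite Rabs_R0, Rmult_0_r; reflexivity).
    apply lim_mult; [apply lim_const|].
    apply (lim_comp _ Rabs); [apply continuous_Rabs|exact Lgh].
Qed.

(** For N = n and w = 0 the level equation is cusp_defect n h = 0. *)
Definition cusp_defect (n : nat) (x : R) : R := cosh (INR n * x) - INR n * cosh x.

Lemma derivable_cusp_defect (n : nat) (x : R) :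
  derivable_pt_lim (cusp_defect n) x (INR n * (sinh (INR n * x) - sinh x)).
Proof.
  apply is_derive_Reals. unfold cusp_defect, cosh, sinh. auto_derive; [trivial|]. field.
Qed.

(** The level equation factors as
    (cosh nh - n cosh h)(cosh nh + n cosh h)
      = - (n sin w - sin nw)(n sin w + sin nw),
    whose right side is o(w^2) by [lim_sin_defect].  The defect has positive
    derivative at hc, so h - hc is o(w^2) too. *)
Lemma height_flat (n : nat) (hc : R) (h : R -> R) :
  (2 <= n)%nat -> 0 < hc -> cusp_defect n hc = 0 ->
  filterlim h (locally' 0) (locally hc) ->
  locally' 0 (fun w => cosh (INR n * h w) ^ 2 - INR n ^ 2 * cosh (h w) ^ 2
    = sin (INR n * w) ^ 2 - INR n ^ 2 * sin w ^ 2) ->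
  filterlim (fun w => (h w - hc) / w ^ 2) (locally' 0) (locally 0).
Proof.
  intros Hn Hc Kc Lh Hlev.
  assert (N1 : 1 < INR n) by (apply lt_1_INR; lia).
  assert (Ss := sinh_mult_gt n hc Hn Hc). assert (s0 := sinh_pos hc Hc).
  apply (lim_o_inverse (cusp_defect n) (INR n * (sinh (INR n * hc) - sinh hc)));
    [apply Rmult_lt_0_compat; nra|apply derivable_cusp_defect|exact Kc|exact Lh|].
  apply (filterlim_ext_loc (fun w => ((INR n * sin w - sin (INR n * w)) / w ^ 2)
       * ((- 1 * (INR n * sin w + sin (INR n * w))) / (cosh (INR n * h w) + INR n * cosh (h w))))).
  { generalize (filter_and _ _ (locally'_neq 0) Hlev). apply filter_imp. intros w [W L].
    assert (P1 := cosh_pos (INR n * h w)). assert (P2 := cosh_pos (h w)).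
    assert (0 < cosh (INR n * h w) + INR n * cosh (h w)) by nra.
    apply Rmult_eq_reg_r with (w ^ 2 * (cosh (INR n * h w) + INR n * cosh (h w)));
      [|apply Rmult_integral_contrapositive; split; [now apply pow_nonzero|lra]].
    unfold cusp_defect. field_simplify; [|lra|lra]. lra. }
  replace (locally 0) with
    (locally (0 * ((-1 * (INR n * 0 + 0)) / (cosh (INR n * hc) + INR n * cosh hc)))) by (f_equal; ring).
  assert (PC := cosh_pos (INR n * hc)). assert (Pc := cosh_pos hc).
  assert (Lsin : filterlim sin (locally' 0) (locally 0)).
  { apply (filterlim_ext (fun w => sin (1 * w))); [intros; now rewrite Rmult_1_l|apply lim_sin_mult_0]. }
  apply lim_mult; [apply lim_sin_defect|]. apply lim_div; [nra| |].
  - apply lim_mult; [apply lim_const|]. apply lim_plus; [|apply lim_sin_mult_0].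
    apply lim_mult; [apply lim_const|exact Lsin].
  - apply lim_plus.
    + apply (lim_comp (fun w => INR n * h w) cosh); [apply continuous_cosh|].
      apply lim_mult; [apply lim_const|exact Lh].
    + apply lim_mult; [apply lim_const|].
      apply (lim_comp h cosh); [apply continuous_cosh|exact Lh].
Qed.

(** Since h - hc = o(w^2), any function of h that vanishes at hc contributes
    o(w^2), so only the explicit dependence on w matters. *)
Lemma axis_expansion (n : nat) (hc : R) (h : R -> R) :
  (2 <= n)%nat -> 0 < hc -> cusp_defect n hc = 0 ->
  filterlim h (locally' 0) (locally hc) ->
  filterlim (fun w => (h w - hc) / w ^ 2) (locally' 0) (locally 0) ->
  filterlim (fun w => axis_re n w (h w) / axis_den n w (h w) / w ^ 2) (locally' 0) (locally 0) /\
  exists l, l < 0 /\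
    filterlim (fun w => (axis_im n w (h w) / axis_den n w (h w)
                         - axis_im n 0 hc / axis_den n 0 hc) / w ^ 2)
      (locally' 0) (locally l).
Proof.
  intros Hn Hc Kc Lh Lhh.
  assert (N1 : 1 < INR n) by (apply lt_1_INR; lia).
  assert (Ss := sinh_mult_gt n hc Hn Hc). assert (s0 := sinh_pos hc Hc).
  assert (PDc := axis_den_pos n 0 hc Hn Hc).
  set (N := INR n) in *.
  set (S1 := sinh (N * hc)) in *. set (s1 := sinh hc) in *.
  set (C1 := cosh (N * hc)). set (c1 := cosh hc).
  set (D1 := axis_den n 0 hc) in *.
  assert (EY : axis_im n 0 hc = S1 - s1).
  { unfold axis_im. rewrite Rmult_0_r, cos_0. unfold S1, s1, N. ring. }
  assert (ED0 : cosh ((N - 1) * hc) - 1 = D1).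
  { unfold D1, axis_den, N. rewrite Rmult_0_r, cos_0. ring. }
  assert (ED : D1 = C1 * c1 - S1 * s1 - 1).
  { rewrite <- ED0. replace ((N - 1) * hc) with (N * hc - hc) by ring.
    rewrite cosh_minus. reflexivity. }
  assert (LK : filterlim (fun w => cusp_defect n (h w) / w ^ 2) (locally' 0) (locally 0)).
  { exact (lim_o_compose _ _ hc h (derivable_cusp_defect n hc) Kc Lh Lhh). }
  assert (LsN : filterlim (fun w => sinh (N * h w)) (locally' 0) (locally S1)).
  { apply (lim_comp (fun w => N * h w) sinh); [apply continuous_sinh|].
    apply lim_mult; [apply lim_const|exact Lh]. }
  assert (Lc1 : filterlim (fun w => cosh (h w)) (locally' 0) (locally c1)).
  { apply (lim_comp h cosh); [apply continuous_cosh|exact Lh]. }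
  assert (Ls1 : filterlim (fun w => sinh (h w)) (locally' 0) (locally s1)).
  { apply (lim_comp h sinh); [apply continuous_sinh|exact Lh]. }
  assert (Lsin : filterlim sin (locally' 0) (locally 0)).
  { apply (filterlim_ext (fun w => sin (1 * w))); [intros; now rewrite Rmult_1_l|apply lim_sin_mult_0]. }
  assert (LD : filterlim (fun w => axis_den n w (h w)) (locally' 0) (locally D1)).
  { unfold axis_den, D1. apply lim_minus.
    - apply (lim_comp (fun w => (N - 1) * h w) cosh); [apply continuous_cosh|].
      apply lim_mult; [apply lim_const|exact Lh].
    - apply (lim_comp (fun w => (N - 1) * w) cos); [apply continuous_cos_R|].
      apply lim_mult; [apply lim_const|apply lim_id_0]. }
  split.
  { apply (filterlim_ext (fun w => (sin w * (cusp_defect n (h w) / w ^ 2)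
       + cosh (h w) * ((N * sin w - sin (N * w)) / w ^ 2)) / axis_den n w (h w))).
    { intros w. unfold axis_re, cusp_defect. fold N. unfold Rdiv. ring. }
    replace (locally 0) with (locally ((0 * 0 + c1 * 0) / D1)) by (f_equal; field; lra).
    apply lim_div; [lra| |exact LD].
    apply lim_plus; apply lim_mult; auto. apply lim_sin_defect. }
  rewrite EY. set (Y1 := (S1 - s1) / D1).
  set (e := fun x => sinh (N * x) - sinh x - Y1 * (cosh ((N - 1) * x) - 1)).
  assert (Le : filterlim (fun w => e (h w) / w ^ 2) (locally' 0) (locally 0)).
  { assert (de : ex_derive e hc) by (unfold e, sinh, cosh; auto_derive; trivial).
    destruct de as [l Hl]. apply is_derive_Reals in Hl.
    apply (lim_o_compose e l hc h Hl); [|exact Lh|exact Lhh].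
    unfold e. rewrite ED0. fold S1 s1. unfold Y1. field. lra. }
  exists (- (N / 2) * ((S1 - s1) / D1)). split.
  { assert (0 < (S1 - s1) / D1) by (apply Rdiv_lt_0_compat; [nra|lra]). nra. }
  apply (filterlim_ext_loc (fun w => (e (h w) / w ^ 2 - (1 - cos (1 * w)) / w ^ 2 * sinh (N * h w)
       + (1 - cos (N * w)) / w ^ 2 * sinh (h w) - Y1 * ((1 - cos ((N - 1) * w)) / w ^ 2))
        / axis_den n w (h w))).
  { assert (PDw := lim_lt (fun _ => 0) _ 0 _ (lim_const 0) LD PDc).
    generalize (filter_and _ _ (locally'_neq 0) PDw). apply filter_imp. intros w [W Pw].
    rewrite Rmult_1_l. unfold axis_im. unfold axis_den in *. fold N. fold N in Pw. unfold e.
    field. split; [lra|exact W]. }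
  replace (- (N / 2) * ((S1 - s1) / D1)) with
    ((0 - 1 ^ 2 / 2 * S1 + N ^ 2 / 2 * s1 - Y1 * ((N - 1) ^ 2 / 2)) / D1).
  2:{ assert (Q := cusp_curvature N C1 c1 S1 s1
        ltac:(unfold cusp_defect in Kc; fold N C1 c1 in Kc; lra) (cosh_sqr _) (cosh_sqr _)).
      rewrite <- ED in Q. unfold Y1.
      apply Rminus_diag_uniq.
      transitivity (((N ^ 2 * s1 - S1) * D1 - (N - 1) ^ 2 * (S1 - s1) - - N * (S1 - s1) * D1)
        / (2 * D1 ^ 2)).
      - field. lra.
      - rewrite Q. unfold Rdiv. ring. }
  apply lim_div; [lra| |exact LD].
  apply lim_minus; [apply lim_plus; [apply lim_minus; [exact Le|]|]|].
  - apply lim_mult; [apply lim_1_minus_cos|exact LsN].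
  - apply lim_mult; [apply lim_1_minus_cos|exact Ls1].
  - apply lim_mult; [apply lim_const|apply lim_1_minus_cos].
Qed.

Lemma u0_borderline (n : nat) : u0 n (INR n) = 0.
Proof. unfold u0. destruct (Req_EM_T (INR n) (INR n)); [reflexivity|congruence]. Qed.

(** The point is approached along the same vertical half-tangent from
    both sides, towards the real axis. *)
Lemma cusp_center (k : eigtype) (n : nat) (sg : R) :
  admissible k n -> sg = 1 \/ sg = -1 -> (2 <= n)%nat ->
  cusp k n (f k n (INR n) (- sg * (PI / 2))).
Proof.
  intros Hk Hsg Hn.
  assert (N1 : 1 < INR n) by (apply lt_1_INR; lia).
  assert (HP := PI_RGT_0).
  set (u := - sg * (PI / 2)).
  assert (Hloc : locally u (Rset n (INR n))).
  { assert (P4 : 0 < PI / 4) by lra. apply (locally_Rabs _ _ (mkposreal _ P4)). intros t Ht.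
    apply Rabs_def2 in Ht. simpl in Ht. unfold Rset. rewrite u0_borderline. unfold u in Ht.
    destruct Hsg; subst sg; [left|right]; lra. }
  split.
  { exists u. split; [|reflexivity]. now apply locally_singleton. }
  exists u. split; [exact Hloc|]. split; [reflexivity|].
  assert (Gc := gap_center k n sg Hk Hsg Hn). fold u in Gc.
  set (N := INR n) in *.
  set (hc := v n N u).
  assert (Hc : 0 < hc) by (apply v_pos; [exact Hn|unfold N in *; lra|exact Gc]).
  set (h := fun w => v n N (u + w)).
  assert (Lu : filterlim (fun w => u + w) (locally' 0) (locally u)).
  { replace (locally u) with (locally (u + 0)) by (f_equal; ring).
    apply lim_plus; [apply lim_const|apply lim_id_0]. }
  assert (Ev : locally' 0 (fun w => 0 < gap n N (u + w))).
  { apply (lim_lt (fun _ => 0) _ 0 _ (lim_const 0) (lim_gap n _ _ _ _ (lim_const N) Lu) Gc). }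
  assert (Lh : filterlim h (locally' 0) (locally hc)).
  { apply (lim_v n (fun _ => N) (fun w => u + w));
      [exact Hn|unfold N in *; lra|lra|apply lim_const|exact Lu|].
    revert Ev. apply filter_imp. intros w Hw. unfold N in *. split; lra. }
  assert (Lev : forall w, 0 < gap n N (u + w) ->
     cosh (N * h w) ^ 2 - N ^ 2 * cosh (h w) ^ 2 = sin (N * w) ^ 2 - N ^ 2 * sin w ^ 2).
  { intros w Hw. unfold u in Hw. rewrite (gap_axis k n N sg w Hk Hsg) in Hw.
    exact (level_axis k n N sg w Hk Hsg Hn ltac:(unfold N in *; lra) (Rlt_le _ _ Hw)). }
  assert (Kc : cusp_defect n hc = 0).
  { assert (L := Lev 0). unfold h in L. rewrite Rplus_0_r in L. fold hc in L.
    specialize (L Gc). rewrite Rmult_0_r, sin_0 in L. unfold cusp_defect. fold N.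
    assert (PC := cosh_pos (N * hc)). assert (Pc := cosh_pos hc).
    assert (0 < N * cosh hc) by (apply Rmult_lt_0_compat; lra). nra. }
  assert (Lhh : filterlim (fun w => (h w - hc) / w ^ 2) (locally' 0) (locally 0)).
  { apply (height_flat n); auto. revert Ev. apply filter_imp. exact Lev. }
  destruct (axis_expansion n hc h Hn Hc Kc Lh Lhh) as [LX [l [Hl LY]]].
  set (Y1 := axis_im n 0 hc / axis_den n 0 hc) in *.
  assert (Fu : f k n N u = (0, sg * Y1)).
  { assert (A := f_axis k n N sg 0 Hk Hsg Hn). simpl in A.
    rewrite Rplus_0_r in A. fold u in A. change (v n N u) with hc in A.
    rewrite (A Hc). fold Y1. f_equal. unfold axis_re. rewrite Rmult_0_r, sin_0.
    unfold Rdiv. ring. }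
  set (X := fun w => sg * (axis_re n w (h w) / axis_den n w (h w))).
  set (Y := fun w => sg * (axis_im n w (h w) / axis_den n w (h w) - Y1)).
  assert (Slope : filterlim (fun w => ((f k n N (u + w) - f k n N u)
      / RtoC (Cmod (f k n N (u + w) - f k n N u)))%C) (locally' 0)
      (locally ((0, (sg * l) / Rabs (sg * l)) : C))).
  { apply (filterlim_ext_loc (fun w => ((X w, Y w) / RtoC (Cmod (X w, Y w)))%C)).
    { revert Ev. apply filter_imp. intros w Hw.
      assert (E : (X w, Y w) = (f k n N (u + w) - f k n N u)%C); [|rewrite E; reflexivity].
      assert (A := f_axis k n N sg w Hk Hsg Hn). simpl in A. fold u in A.
      rewrite A, Fu by (apply v_pos; [exact Hn|unfold N in *; lra|exact Hw]).
      change (v n N (u + w)) with (h w).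
      unfold X, Y, Cminus, Cplus, Copp; simpl fst; simpl snd. f_equal; ring. }
    apply lim_direction; [destruct Hsg; subst sg; nra|apply locally'_neq| |]; unfold X, Y.
    - apply (filterlim_ext (fun w => sg * (axis_re n w (h w) / axis_den n w (h w) / w ^ 2))).
      { intros w. unfold Rdiv. ring. }
      replace (locally 0) with (locally (sg * 0)) by (f_equal; ring).
      apply lim_mult; [apply lim_const|exact LX].
    - apply (filterlim_ext (fun w => sg * ((axis_im n w (h w) / axis_den n w (h w) - Y1) / w ^ 2))).
      { intros w. unfold Rdiv. ring. }
      apply lim_mult; [apply lim_const|exact LY]. }
  exists ((0, (sg * l) / Rabs (sg * l)) : C). split.
  - assert (E : sg * l / Rabs (sg * l) = - sg).
    { destruct Hsg; subst sg.
      - rewrite Rabs_left by lra. field. lra.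
      - rewrite Rabs_pos_eq by lra. field. lra. }
    rewrite E. unfold Cmod; simpl fst; simpl snd.
    replace (0 ^ 2 + (- sg) ^ 2) with 1 by (destruct Hsg; subst sg; ring). apply sqrt_1.
  - apply (filterlim_ext (fun t => ((f k n N (u + (t - u)) - f k n N u)
      / RtoC (Cmod (f k n N (u + (t - u)) - f k n N u)))%C)).
    { intros t. replace (u + (t - u)) with t by ring. reflexivity. }
    apply (filterlim_comp _ _ _ (fun t => t - u) (fun w => ((f k n N (u + w) - f k n N u)
      / RtoC (Cmod (f k n N (u + w) - f k n N u)))%C) _ (locally' 0)); [|exact Slope].
    intros P [d Hd]. exists d. intros t Ht Hne. apply Hd; [|lra].
    ball_abs in *.
    rewrite Ropp_0, Rplus_0_r. exact Ht.
Qed.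

(** * The value at the removable singularity *)

(** The quotient sin jz / sin z, that is U_{j-1}(cos z) at a complex argument.
    Being a polynomial in cos z, it is continuous where sin z vanishes. *)
Fixpoint CchebU (j : nat) (z : C) : C :=
  match j with
  | 0%nat => RtoC 0
  | S j' =>
      match j' with
      | 0%nat => RtoC 1
      | S j'' => (RtoC 2 * Ccos z * CchebU j' z - CchebU j'' z)%C
      end
  end.

Lemma RtoC_mult_pair (a : R) (z : C) : (RtoC a * z)%C = (a * Re z, a * Im z).
Proof. destruct z. unfold Cmult, RtoC; simpl. f_equal; ring. Qed.

Lemma Csin_mult (j : nat) (z : C) : Csin (RtoC (INR j) * z)%C = (CchebU j z * Csin z)%C.
Proof.
  enough (H : Csin (RtoC (INR j) * z)%C = (CchebU j z * Csin z)%C /\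
     Csin (RtoC (INR (S j)) * z)%C = (CchebU (S j) z * Csin z)%C) by apply H.
  induction j as [|j [IH1 IH2]].
  - split.
    + rewrite RtoC_mult_pair. unfold Csin; simpl.
      rewrite !Rmult_0_l, sin_0, sinh_0, Cmult_0_l. unfold RtoC. f_equal; ring.
    + rewrite RtoC_mult_pair. unfold Csin; simpl. rewrite !Rmult_1_l, Cmult_1_l. reflexivity.
  - split; [exact IH2|].
    change (CchebU (S (S j)) z) with (RtoC 2 * Ccos z * CchebU (S j) z - CchebU j z)%C.
    transitivity (RtoC 2 * Ccos z * (CchebU (S j) z * Csin z) - CchebU j z * Csin z)%C; [|ring].
    rewrite <- IH1, <- IH2. rewrite !RtoC_mult_pair, !S_INR.
    destruct z as [x y]. unfold Csin, Ccos; simpl Re; simpl Im.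
    replace ((INR j + 1 + 1) * x) with ((INR j + 1) * x + x) by ring.
    replace ((INR j + 1 + 1) * y) with ((INR j + 1) * y + y) by ring.
    replace (INR j * x) with ((INR j + 1) * x - x) by ring.
    replace (INR j * y) with ((INR j + 1) * y - y) by ring.
    set (p := (INR j + 1) * x). set (q := (INR j + 1) * y).
    rewrite sin_plus, cos_plus, sin_minus, cos_minus,
      sinh_plus, cosh_plus, sinh_minus, cosh_minus.
    unfold Cminus, Cplus, Copp, Cmult, RtoC; simpl. f_equal; ring.
Qed.

Lemma lim_Cmult {T} {F : (T -> Prop) -> Prop} {FF : Filter F} (g h : T -> C) (a b : C) :
  filterlim g F (locally a) -> filterlim h F (locally b) ->
  filterlim (fun t => g t * h t)%C F (locally (a * b)%C).
Proof.
  intros Hg Hh. unfold Cmult.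
  assert (H1 := lim_fst _ _ Hg). assert (H2 := lim_snd _ _ Hg).
  assert (H3 := lim_fst _ _ Hh). assert (H4 := lim_snd _ _ Hh).
  apply lim_pair; [apply lim_minus|apply lim_plus]; apply lim_mult; assumption.
Qed.

Lemma lim_Cminus {T} {F : (T -> Prop) -> Prop} {FF : Filter F} (g h : T -> C) (a b : C) :
  filterlim g F (locally a) -> filterlim h F (locally b) ->
  filterlim (fun t => g t - h t)%C F (locally (a - b)%C).
Proof.
  intros Hg Hh. unfold Cminus, Cplus, Copp; simpl.
  assert (H1 := lim_fst _ _ Hg). assert (H2 := lim_snd _ _ Hg).
  assert (H3 := lim_fst _ _ Hh). assert (H4 := lim_snd _ _ Hh).
  apply lim_pair; apply lim_minus; assumption.
Qed.

Lemma lim_Cinv {T} {F : (T -> Prop) -> Prop} {FF : Filter F} (g : T -> C) (a : C) :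
  a <> RtoC 0 -> filterlim g F (locally a) ->
  filterlim (fun t => / g t)%C F (locally (/ a)%C).
Proof.
  intros Ha Hg. unfold Cinv.
  assert (H1 := lim_fst _ _ Hg). assert (H2 := lim_snd _ _ Hg).
  assert (Hn : fst a ^ 2 + snd a ^ 2 <> 0).
  { intros H. apply Ha. destruct a as [x y]; simpl in H. unfold RtoC.
    f_equal; generalize (pow2_ge_0 x) (pow2_ge_0 y); nra. }
  apply lim_pair; (apply lim_div; [exact Hn| |apply lim_plus; apply lim_pow; assumption]).
  - exact H1.
  - apply (lim_comp _ Ropp); [|exact H2]. apply (continuous_opp (fun x : R => x)), continuous_id.
Qed.

Lemma lim_CchebU {T} {F : (T -> Prop) -> Prop} {FF : Filter F} (j : nat) (z : T -> C) :
  filterlim z F (locally (RtoC 0)) ->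
  filterlim (fun t => CchebU j (z t)) F (locally (RtoC (INR j))).
Proof.
  intros Hz.
  assert (Lc : filterlim (fun t => Ccos (z t)) F (locally (RtoC 1))).
  { assert (H1 := lim_fst _ _ Hz). assert (H2 := lim_snd _ _ Hz). simpl in H1, H2.
    replace (RtoC 1) with ((cos 0 * cosh 0, - (sin 0 * sinh 0)) : C).
    2:{ rewrite cos_0, cosh_0, sin_0, sinh_0. unfold RtoC. f_equal; ring. }
    unfold Ccos, Re, Im. apply lim_pair.
    - apply lim_mult; [apply (lim_comp _ cos)|apply (lim_comp _ cosh)]; auto.
      apply continuous_cos_R. apply continuous_cosh.
    - apply (lim_comp _ Ropp); [apply (continuous_opp (fun x : R => x)), continuous_id|].
      apply lim_mult; [apply (lim_comp _ sin)|apply (lim_comp _ sinh)]; auto.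
      apply continuous_sin_R. apply continuous_sinh. }
  enough (H : filterlim (fun t => CchebU j (z t)) F (locally (RtoC (INR j))) /\
    filterlim (fun t => CchebU (S j) (z t)) F (locally (RtoC (INR (S j))))) by apply H.
  induction j as [|j [IH1 IH2]].
  - split; simpl; apply filterlim_const.
  - split; [exact IH2|].
    replace (RtoC (INR (S (S j)))) with (RtoC 2 * RtoC 1 * RtoC (INR (S j)) - RtoC (INR j))%C.
    2:{ rewrite <- !RtoC_mult, <- RtoC_minus, !S_INR. f_equal. ring. }
    apply lim_Cminus; [|exact IH1]. apply lim_Cmult; [|exact IH2].
    apply lim_Cmult; [apply filterlim_const|exact Lc].
Qed.

Lemma borderline_gap_pos (n : nat) (u : R) :
  (2 <= n)%nat -> sin u <> 0 -> 0 < gap n (INR n) u.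
Proof.
  intros Hn Hu. assert (H := abs_sin_mult_lt n u Hn Hu).
  unfold gap. rewrite <- (pow2_abs (sin (INR n * u))), <- (pow2_abs (sin u)).
  generalize (Rabs_pos (sin (INR n * u))). nra.
Qed.

Lemma gap_0 (n : nat) (N : R) : gap n N 0 = 0.
Proof. unfold gap. rewrite Rmult_0_r, sin_0. ring. Qed.

Lemma v_0 (n : nat) (N : R) : (2 <= n)%nat -> 0 <= N <= INR n -> v n N 0 = 0.
Proof.
  intros Hn HN. assert (G := gap_0 n N).
  destruct (v_spec n N 0 Hn HN ltac:(lra)) as [[V|V] E]; [exfalso|auto].
  assert (L := lift_lt n N 0 _ Hn HN (conj (Rle_refl 0) V)).
  rewrite E, G in L. unfold lift in L. rewrite Rmult_0_r, sinh_0 in L. lra.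
Qed.

Lemma sin_neq_0 (u : R) : u <> 0 -> - PI < u < PI -> sin u <> 0.
Proof.
  intros Hu Hb. destruct (Rlt_le_dec u 0).
  - apply Rlt_not_eq, sin_lt_0_var; lra.
  - apply Rgt_not_eq, sin_gt_0; lra.
Qed.

(** Dividing numerator and denominator by sin mu leaves the quotient of
    U_{m}(cos mu) and U_{m-1}(cos mu) with m = (n - 1) / 2, and mu tends to 0. *)
Lemma lim_quotient_at_0 (n : nat) :
  (n mod 4 = 1)%nat -> (2 <= n)%nat ->
  filterlim (fun t => (f_num type1 n (INR n) t / f_den type1 n (INR n) t)%C)
    (within (Rset n (INR n)) (locally' 0)) (locally (RtoC ((INR n + 1) / (INR n - 1)))).
Proof.
  intros Hm Hn.
  assert (N1 : 1 < INR n) by (apply lt_1_INR; lia).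
  set (F := within (Rset n (INR n)) (locally' 0)).
  assert (FF : Filter F) by (apply within_filter; typeclasses eauto).
  assert (Hd := Nat.div_mod n 4 ltac:(lia)). rewrite Hm in Hd.
  set (b := (2 * (n / 4))%nat).
  assert (Eb : (INR n - 1) / 2 = INR b).
  { unfold b. rewrite Hd at 1. rewrite plus_INR, !mult_INR. simpl. field. }
  assert (Ea : (INR n + 1) / 2 = INR (S b)) by (rewrite S_INR, <- Eb; field).
  assert (b0 : 0 < INR b) by lra.
  assert (Lid : filterlim (fun t : R => t) F (locally 0)).
  { intros P [e He]. exists e. intros t Ht _ _. apply He, Ht. }
  assert (G0 : forall t, 0 <= gap n (INR n) t).
  { intros t. destruct (Req_dec (sin t) 0) as [E|E].
    - unfold gap. assert (K := abs_sin_mult_le n t). rewrite E, Rabs_R0, Rmult_0_r in K.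
      assert (Z : Rabs (sin (INR n * t)) = 0) by (apply Rle_antisym; [exact K|apply Rabs_pos]).
      rewrite E, <- (pow2_abs (sin (INR n * t))), Z. lra.
    - left. now apply borderline_gap_pos. }
  assert (Lv : filterlim (fun t => v n (INR n) t) F (locally 0)).
  { replace (locally 0) with (locally (v n (INR n) 0)) by (f_equal; apply v_0; [exact Hn|lra]).
    apply (lim_v n (fun _ => INR n) (fun t => t)); auto; [lra|apply lim_const|].
    apply filter_forall. intros t. split; [lra|apply G0]. }
  assert (Lmu : filterlim (mu n (INR n)) F (locally (RtoC 0))).
  { unfold mu. apply lim_pair; assumption. }
  assert (La := lim_CchebU (S b) _ Lmu). assert (Lb := lim_CchebU b _ Lmu).
  assert (Lre : F (fun t => 0 < Re (CchebU b (mu n (INR n) t)))).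
  { apply (lim_lt (fun _ => 0) _ 0 (INR b)); [apply lim_const|apply (lim_fst _ _ Lb)|exact b0]. }
  apply (filterlim_ext_loc (fun t => (CchebU (S b) (mu n (INR n) t) * / CchebU b (mu n (INR n) t))%C)).
  - assert (Hpi : F (fun t => sin t <> 0)).
    { exists (mkposreal _ PI_RGT_0). intros t Ht Hne _. apply sin_neq_0; [exact Hne|].
      ball_abs in Ht.
      apply Rabs_def2 in Ht. lra. }
    generalize (filter_and _ _ Lre Hpi). apply filter_imp. intros t [Rt St].
    unfold f_num, f_den. rewrite Ea, Eb. change (trig type1) with Csin. rewrite !Csin_mult.
    assert (Z : Csin (mu n (INR n) t) <> RtoC 0).
    { assert (V := v_pos n (INR n) t Hn ltac:(lra) (borderline_gap_pos n t Hn St)).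
      intros E. injection E as E1 _. apply Rmult_integral in E1. destruct E1 as [E1|E1].
      - apply St, E1.
      - generalize (cosh_pos (v n (INR n) t)). unfold mu in E1; simpl in E1. lra. }
    assert (Q : CchebU b (mu n (INR n) t) <> RtoC 0).
    { intros E. rewrite E in Rt. simpl in Rt. lra. }
    revert Z Q. generalize (CchebU (S b) (mu n (INR n) t)) (CchebU b (mu n (INR n) t)).
    intros qa qb Z Q. field. split; assumption.
  - replace (RtoC ((INR n + 1) / (INR n - 1))) with (RtoC (INR (S b)) * / RtoC (INR b))%C.
    2:{ rewrite <- RtoC_inv by lra. rewrite <- RtoC_mult. f_equal. rewrite <- Ea, <- Eb.
        field. lra. }
    apply lim_Cmult; [exact La|]. apply lim_Cinv; [|exact Lb].
    intros E. injection E. lra.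
Qed.

(** For type 1 both numerator and denominator vanish at 0, and f takes the value of
    the limit; limits along the parameter set are unique because it
    accumulates at 0. *)
Lemma Im_f_0 (k : eigtype) (n : nat) :
  admissible k n -> (2 <= n)%nat -> Im (f k n (INR n) 0) = 0.
Proof.
  intros Hk Hn. assert (HP := PI_RGT_0).
  assert (N1 : 1 < INR n) by (apply lt_1_INR; lia).
  assert (V := v_0 n (INR n) Hn ltac:(lra)).
  assert (M : forall a : R, (RtoC a * mu n (INR n) 0)%C = (0, 0)).
  { intros a. rewrite RtoC_mult_pair. unfold mu. rewrite V. simpl. f_equal; ring. }
  destruct Hk as [[-> Hm]|[-> _]].
  - unfold f. destruct (excluded_middle_informative _) as [_|H].
    + match goal with |- context [epsilon ?i ?P] =>
        assert (L := epsilon_spec i P (ex_intro P _ (lim_quotient_at_0 n Hm Hn)));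
        set (l0 := epsilon i P) in * end. cbv beta in L.
      set (F := within (Rset n (INR n)) (locally' 0)) in *.
      assert (PF : ProperFilter' F).
      { constructor; [|apply within_filter; typeclasses eauto].
        intros [d Hd].
        set (t := Rmin (d / 2) (PI / 2)).
        assert (Ht : 0 < t <= d / 2 /\ t <= PI / 2).
        { unfold t. generalize (cond_pos d) (Rmin_l (d / 2) (PI / 2)) (Rmin_r (d / 2) (PI / 2)).
          assert (0 < Rmin (d / 2) (PI / 2)) by (generalize (cond_pos d); intros; apply Rmin_glb_lt; lra).
          lra. }
        apply (Hd t).
        - ball_abs.
          rewrite Rabs_pos_eq; generalize (cond_pos d); lra.
        - lra.
        - right. rewrite u0_borderline. lra. }
      assert (L1 := lim_snd _ _ L). assert (L2 := lim_snd _ _ (lim_quotient_at_0 n Hm Hn)).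
      exact (filterlim_locally_unique (V := R_NormedModule) _ _ _ L1 L2).
    + exfalso. apply H. unfold f_den. rewrite M. unfold trig, Csin; simpl.
      rewrite sin_0, sinh_0. unfold RtoC. f_equal; ring.
  - unfold f. destruct (excluded_middle_informative _) as [H|_].
    + exfalso. unfold f_den in H. rewrite M in H. unfold trig, Ccos in H; simpl in H.
      rewrite cos_0, cosh_0 in H. injection H. lra.
    + unfold f_num, f_den. rewrite !M. unfold trig, Ccos; simpl.
      rewrite cos_0, cosh_0, sin_0, sinh_0. field.
Qed.

(** * Uniqueness of the cusp in each half-axis *)

(** Squaring axis_re = 0 and inserting the level equation gives
    (n^2 sin^2 w - sin^2 nw)(cosh^2 h - sin^2 w) = 0, and both factors are positive
    unless sin w = 0. *)
Lemma axis_re_zero (n : nat) (w h : R) :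
  (2 <= n)%nat -> 0 < h ->
  cosh (INR n * h) ^ 2 - INR n ^ 2 * cosh h ^ 2 = sin (INR n * w) ^ 2 - INR n ^ 2 * sin w ^ 2 ->
  axis_re n w h = 0 -> sin w = 0.
Proof.
  intros Hn Hh L Z. unfold axis_re in Z.
  destruct (Req_dec (sin w) 0) as [|Hs]; [assumption|exfalso].
  assert (K := abs_sin_mult_lt n w Hn Hs).
  assert (K2 : sin (INR n * w) ^ 2 < INR n ^ 2 * sin w ^ 2).
  { rewrite <- (pow2_abs (sin (INR n * w))), <- (pow2_abs (sin w)).
    generalize (Rabs_pos (sin (INR n * w))). nra. }
  assert (Z2 : sin w ^ 2 * cosh (INR n * h) ^ 2 = sin (INR n * w) ^ 2 * cosh h ^ 2).
  { replace (sin w ^ 2 * cosh (INR n * h) ^ 2) with ((sin w * cosh (INR n * h)) ^ 2) by ring.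
    replace (sin w * cosh (INR n * h)) with (sin (INR n * w) * cosh h) by lra. ring. }
  assert (c1 := cosh_gt_1 h Hh).
  assert (sin w ^ 2 <= 1) by (rewrite sin_sqr; generalize (pow2_ge_0 (cos w)); lra).
  assert (1 < cosh h ^ 2) by nra.
  assert (E : (INR n ^ 2 * sin w ^ 2 - sin (INR n * w) ^ 2) * (cosh h ^ 2 - sin w ^ 2) = 0).
  { replace (cosh (INR n * h) ^ 2) with
      (INR n ^ 2 * cosh h ^ 2 + (sin (INR n * w) ^ 2 - INR n ^ 2 * sin w ^ 2)) in Z2 by lra.
    lra. }
  apply Rmult_integral in E. lra.
Qed.

Lemma cusp_center_axis (k : eigtype) (n : nat) (sg : R) :
  admissible k n -> sg = 1 \/ sg = -1 -> (2 <= n)%nat ->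
  Re (f k n (INR n) (- sg * (PI / 2))) = 0 /\ half sg (f k n (INR n) (- sg * (PI / 2))).
Proof.
  intros Hk Hsg Hn.
  assert (N1 : 1 < INR n) by (apply lt_1_INR; lia).
  assert (Gc := gap_center k n sg Hk Hsg Hn).
  assert (Hv := v_pos n (INR n) _ Hn ltac:(lra) Gc).
  assert (A := f_axis k n (INR n) sg 0 Hk Hsg Hn). simpl in A.
  rewrite Rplus_0_r in A. rewrite (A Hv). unfold half; simpl Re; simpl Im. split.
  - unfold axis_re. rewrite Rmult_0_r, sin_0. unfold Rdiv. ring.
  - set (h := v n (INR n) (- sg * (PI / 2))) in *.
    assert (0 < axis_im n 0 h / axis_den n 0 h).
    { apply Rdiv_lt_0_compat; [|now apply axis_den_pos].
      apply axis_im_pos with (INR n); [exact Hn|lra|exact Hv| |rewrite cos_0; lra].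
      rewrite Rmult_0_r, cos_0. nra. }
    destruct Hsg; subst sg; lra.
Qed.

(** Interiority of the parameter leaves -PI < u < PI.  The sign of the imaginary
    part is that of sg cos w, so the half-plane selects cos w > 0, and with
    sin w = 0 this leaves only w = 0. *)
Lemma cusp_axis_unique (k : eigtype) (n : nat) (sg : R) (rho : C) :
  admissible k n -> sg = 1 \/ sg = -1 -> (2 <= n)%nat ->
  cusp k n rho -> Re rho = 0 -> half sg rho ->
  rho = f k n (INR n) (- sg * (PI / 2)).
Proof.
  intros Hk Hsg Hn [_ [u [[d Hd] [-> _]]]] HR HI.
  change (UniformSpace.sort R_UniformSpace) with R in u.
  assert (HP := PI_RGT_0).
  assert (N1 : 1 < INR n) by (apply lt_1_INR; lia).
  assert (Hu : - PI < u < PI).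
  { assert (B : forall t, Rabs t < d -> Rset n (INR n) (u + t)).
    { intros t Ht. apply Hd. ball_abs.
      replace (u + t + - u) with t by ring. exact Ht. }
    assert (Pd := cond_pos d).
    assert (B1 := B (d / 2) ltac:(rewrite Rabs_pos_eq; lra)).
    assert (B2 := B (- (d / 2)) ltac:(rewrite Rabs_left; lra)).
    unfold Rset in B1, B2. rewrite u0_borderline in B1, B2. lra. }
  destruct (Req_dec u 0) as [->|Hu0].
  { exfalso. unfold half in HI. rewrite Im_f_0 in HI by assumption. lra. }
  assert (G := borderline_gap_pos n u Hn (sin_neq_0 u Hu0 Hu)).
  assert (Hv := v_pos n (INR n) u Hn ltac:(lra) G).
  set (w := u + sg * (PI / 2)).
  assert (Ew : u = - sg * (PI / 2) + w) by (unfold w; ring).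
  assert (A := f_axis k n (INR n) sg w Hk Hsg Hn). simpl in A. rewrite <- Ew in A.
  specialize (A Hv).
  assert (Gw : 0 < INR n ^ 2 * cos w ^ 2 - cos (INR n * w) ^ 2).
  { rewrite <- (gap_axis k n (INR n) sg w Hk Hsg), <- Ew. exact G. }
  assert (L := level_axis k n (INR n) sg w Hk Hsg Hn ltac:(lra) (Rlt_le _ _ Gw)).
  simpl in L. rewrite <- Ew in L.
  set (h := v n (INR n) u) in *.
  assert (PD := axis_den_pos n w h Hn Hv).
  rewrite A in HR, HI. simpl Re in HR. unfold half in HI; simpl Im in HI.
  assert (sin w = 0) as Sw.
  { apply (axis_re_zero n w h Hn Hv L).
    assert (Z : axis_re n w h / axis_den n w h = 0) by (destruct Hsg; subst sg; lra).
    apply (Rmult_eq_reg_r (/ axis_den n w h)); [unfold Rdiv in Z; lra|].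
    apply Rinv_neq_0_compat. lra. }
  (* If cos w < 0 then both terms of axis_im compare the other way round. *)
  assert (Cw : 0 < cos w).
  { apply Rnot_le_lt. intros Hc.
    assert (IM : axis_im n w h < 0).
    { assert (Hc' : cos w < 0).
      { destruct Hc as [Hc|Hc]; [exact Hc|]. generalize (sin_sqr w). rewrite Sw, Hc. lra. }
      unfold axis_im.
      assert (S1 := sinh_mult_gt n h Hn Hv). assert (S2 := sinh_pos h Hv).
      assert (INR n * cos w <= cos (INR n * w)).
      { apply Rnot_lt_le. intros H.
        assert (INR n * cos w < 0) by nra. nra. }
      nra. }
    assert (axis_im n w h / axis_den n w h < 0).
    { unfold Rdiv. assert (0 < / axis_den n w h) by now apply Rinv_0_lt_compat. nra. }
    destruct Hsg; subst sg; lra. }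
  assert (w0 : w = 0).
  { destruct (Req_dec w 0) as [|Hw]; [assumption|exfalso].
    assert (Hw2 : - (3 * (PI / 2)) < w < 3 * (PI / 2)) by (unfold w; destruct Hsg; subst sg; lra).
    destruct (Rle_lt_dec (PI / 2) (Rabs w)) as [H|H].
    - assert (cos w <= 0); [|lra].
      unfold Rabs in H. destruct (Rcase_abs w) in H.
      + rewrite <- cos_neg. apply cos_le_0; lra.
      + apply cos_le_0; lra.
    - apply Rabs_def2 in H. apply (sin_neq_0 w Hw); [lra|exact Sw]. }
  f_equal. rewrite Ew, w0. ring.
Qed.

(** * Loops shrinking to the cusp *)

Lemma axis_cusp_limit (k : eigtype) (n : nat) (sg : R) :
  admissible k n -> sg = 1 \/ sg = -1 -> (3 <= n)%nat ->
  exists rho_c : C,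
    unique (fun rho => cusp k n rho /\ Re rho = 0 /\ half sg rho) rho_c /\
    shrinks_to k n (fun N => - sg * (PI / 2) - u0 n N)
      (fun N => - sg * (PI / 2) + u0 n N) rho_c.
Proof.
  intros Hk Hsg Hn. exists (f k n (INR n) (- sg * (PI / 2))). split; [split|].
  - destruct (cusp_center_axis k n sg Hk Hsg ltac:(lia)) as [HR HI].
    split; [apply cusp_center; auto; lia|split; assumption].
  - intros rho (H1 & H2 & H3). symmetry. apply cusp_axis_unique; auto; lia.
  - now apply shrinks_half.
Qed.

Theorem theorem5p4 :
  forall (n : nat) (k : eigtype),
  (3 <= n)%nat -> Nat.Odd n ->
  (k = type1 /\ (n mod 4 = 1)%nat) \/ (k = type2 /\ (n mod 4 = 3)%nat) ->
  (forall N : R, N_min n < N < INR n ->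
    loops_in k n N upper /\
    loops_in k n N lower /\
    is_loop k n N upper (- (PI / 2) - u0 n N) (- (PI / 2) + u0 n N) /\
    is_loop k n N lower (PI / 2 - u0 n N) (PI / 2 + u0 n N) /\
    (exists rho_upper : C,
      rho_upper = f k n N (- (PI / 2) - u0 n N) /\
      rho_upper = f k n N (- (PI / 2) + u0 n N) /\
      Re rho_upper = 0) /\
    (exists rho_lower : C,
      rho_lower = f k n N (PI / 2 - u0 n N) /\
      rho_lower = f k n N (PI / 2 + u0 n N) /\
      Re rho_lower = 0)) /\
  (exists rho_c : C,
    unique (fun rho => cusp k n rho /\ Re rho = 0 /\ 0 < Im rho) rho_c /\
    shrinks_to k n (fun N => - (PI / 2) - u0 n N)
      (fun N => - (PI / 2) + u0 n N) rho_c) /\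
  (exists rho_c : C,
    unique (fun rho => cusp k n rho /\ Re rho = 0 /\ Im rho < 0) rho_c /\
    shrinks_to k n (fun N => PI / 2 - u0 n N)
      (fun N => PI / 2 + u0 n N) rho_c).
Proof.
  intros n k Hn _ Hk.
  assert (Up : forall rho, half 1 rho <-> upper rho).
  { intros rho. unfold half, upper. rewrite Rmult_1_l. reflexivity. }
  assert (Lo : forall rho, half (-1) rho <-> lower rho).
  { intros rho. unfold half, lower. split; lra. }
  assert (E1 : - (1) * (PI / 2) = - (PI / 2)) by ring.
  assert (E2 : - (-1) * (PI / 2) = PI / 2) by ring.
  split; [|split].
  - intros N HN.
    assert (L1 : is_loop k n N upper (- (PI / 2) - u0 n N) (- (PI / 2) + u0 n N)).
    { destruct (is_loop_half k n N 1 Hk (or_introl eq_refl) Hn HN) as (A & B & D & H).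
      rewrite E1 in *. split; [exact A|split; [exact B|split; [exact D|]]].
      intros rho Hr. apply Up, H, Hr. }
    assert (L2 : is_loop k n N lower (PI / 2 - u0 n N) (PI / 2 + u0 n N)).
    { destruct (is_loop_half k n N (-1) Hk (or_intror eq_refl) Hn HN) as (A & B & D & H).
      rewrite E2 in *. split; [exact A|split; [exact B|split; [exact D|]]].
      intros rho Hr. apply Lo, H, Hr. }
    split; [eexists; eexists; exact L1|].
    split; [eexists; eexists; exact L2|].
    split; [exact L1|]. split; [exact L2|]. split.
    + exists (f k n N (- (PI / 2) - u0 n N)). split; [reflexivity|]. split; [apply L1|].
      apply (self_intersection k n N 1); auto. left. ring.
    + exists (f k n N (PI / 2 - u0 n N)). split; [reflexivity|]. split; [apply L2|].
      apply (self_intersection k n N (-1)); auto. left. ring.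
  - destruct (axis_cusp_limit k n 1 Hk (or_introl eq_refl) Hn) as [c [[[H1 [H2 H3]] Hu] Hs]].
    rewrite E1 in Hs. exists c. split; [|exact Hs]. split.
    + split; [exact H1|split; [exact H2|apply Up; exact H3]].
    + intros rho (A & B & D). apply Hu. split; [exact A|split; [exact B|apply Up; exact D]].
  - destruct (axis_cusp_limit k n (-1) Hk (or_intror eq_refl) Hn) as [c [[[H1 [H2 H3]] Hu] Hs]].
    rewrite E2 in Hs. exists c. split; [|exact Hs]. split.
    + split; [exact H1|split; [exact H2|apply Lo; exact H3]].
    + intros rho (A & B & D). apply Hu. split; [exact A|split; [exact B|apply Lo; exact D]].
Qed.
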